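(* Let $[u,v]$ be an interval in the strong Bruhat order of $S_n$ such that $u\le_W v$ in the left weak Bruhat order. Then the twisted Bruhat interval polytope $\tilde{P}_{[u,v]}$ is an MV polytope.
   Context: For an interval $[u,v]$ in the strong Bruhat order of $S_n$, the twisted Bruhat interval polytope is $$\tilde{P}_{[u,v]}=\operatorname{conv}\bigl((n+1-w^{-1}(1),\,n+1-w^{-1}(2),\dots,n+1-w^{-1}(n)) : w\in[u,v]\bigr)\subseteq\mathbb{R}^n.$$ The left weak Bruhat order: $u\le_W v$ if there exist reduced expressions $u=s_{i_1}\cdots s_{i_k}$ and $v=s_{j_1}\cdots s_{j_m}s_{i_1}\cdots s_{i_k}$ in the simple transpositions. A generalized permutahedron on $[n]$ is a polytope $P\subseteq\mathbb{R}^n$ such that every edge of $P$ is parallel to a vector $e_i-e_j$ with $i\neq j$ (points are allowed), where $e_1,\dots,e_n$ is the standard basis. It is a lattice generalized permutahedron if all its vertices lie in $\mathbb{Z}^n$. Its supermodular function is $\mu^P(S)=\min_{x\in P}\sum_{i\in S}x_i$ for $S\subseteq[n]$. A lattice generalized permutahedron $P$ is a Mirković–Vilonen (MV) polytope on $[n]$ if for all $S\subseteq[n]$ and all $a<b<c$ in $[n]\setminus S$, $$\mu^P(S\cup\{b\})+\mu^P(S\cup\{a,c\})=\min\bigl(\mu^P(S\cup\{a\})+\mu^P(S\cup\{b,c\}),\ \mu^P(S\cup\{a,b\})+\mu^P(S\cup\{c\})\bigr).$$ *)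

(* Defs.v *)
From Stdlib Require Import Relation_Operators.
From mathcomp Require Import all_boot all_order all_fingroup all_algebra.
From mathcomp Require Import boolp classical_sets reals.

Set Implicit Arguments.
Unset Strict Implicit.
Unset Printing Implicit Defensive.

Import Order.TTheory GRing.Theory Num.Theory.
Local Open Scope classical_set_scope.
Local Open Scope ring_scope.

(* Indices are shifted by one throughout: [n] = {1, ..., n} is 'I_n. *)

Section Permutations.
Variable n : nat.
Implicit Types (u v w s t : 'S_n) (a b : seq 'S_n).

Definition transposition t : Prop := exists i j : 'I_n, i != j /\ t = tperm i j.

Definition simple_transposition s : Prop :=
  exists i j : 'I_n, j = i.+1 :> nat /\ s = tperm i j.

(* [perm_comp u v] is u ∘ v; MathComp's group law reads (s * t) i = t (s i),
   i.e. it composes in the opposite order. *)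
Definition perm_comp u v : 'S_n := (v * u)%g.

(* s_1 ... s_k stands for the composite s_1 ∘ ... ∘ s_k. *)
Definition word_perm a : 'S_n := foldr perm_comp 1%g a.

Definition expression a w : Prop :=
  (forall s, s \in a -> simple_transposition s) /\ word_perm a = w.

Definition reduced_expression a w : Prop :=
  expression a w /\ forall b, expression b w -> (size a <= size b)%N.

Definition has_length w (k : nat) : Prop :=
  exists a, reduced_expression a w /\ size a = k.

Definition bruhat_step u v : Prop :=
  exists t k l,
    [/\ transposition t, v = perm_comp u t, has_length u k, has_length v l
      & (k < l)%N].

Definition bruhat_le : 'S_n -> 'S_n -> Prop := clos_refl_trans 'S_n bruhat_step.

Definition bruhat_interval u v : set 'S_n :=
  [set w | bruhat_le u w /\ bruhat_le w v].

Definition left_weak_le u v : Prop :=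
  exists a b, reduced_expression a u /\ reduced_expression (b ++ a) v.

End Permutations.

Section Polytopes.
Variables (R : realType) (n : nat).
Implicit Types (P X : set 'rV[R]_n) (x p q c : 'rV[R]_n) (S : {set 'I_n}).

Definition conv_hull X : set 'rV[R]_n :=
  [set x | exists (k : nat) (l : 'I_k -> R) (p : 'I_k -> 'rV[R]_n),
    [/\ forall i, 0 <= l i, \sum_i l i = 1, forall i, X (p i)
      & x = \sum_i l i *: p i]].

Definition polytope P : Prop :=
  exists s : seq 'rV[R]_n, P = conv_hull [set` s].

Definition dot c x : R := \sum_i c 0 i * x 0 i.

(* The face of P maximizing the linear functional x |-> c . x; c = 0 gives
   P itself. *)
Definition face P c : set 'rV[R]_n :=
  [set x | P x /\ forall y, P y -> dot c y <= dot c x].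

Definition vertex P p : Prop := exists c, face P c = [set p].

(* The segment [p, q] is a one-dimensional face of P. *)
Definition edge P p q : Prop :=
  p != q /\ exists c, face P c = conv_hull [set p; q].

Definition std_basis (i : 'I_n) : 'rV[R]_n := delta_mx 0 i.

Definition generalized_permutahedron P : Prop :=
  polytope P /\
  forall p q, edge P p q ->
    exists (i j : 'I_n) (r : R),
      i != j /\ q - p = r *: (std_basis i - std_basis j).

Definition lattice_generalized_permutahedron P : Prop :=
  generalized_permutahedron P /\
  forall p, vertex P p -> forall i, p 0 i \is a Num.int.

(* mu S = min_{x in P} \sum_(i in S) x_i, the minimum being attained. *)
Definition is_supermodular_function P (mu : {set 'I_n} -> R) : Prop :=
  forall S,
    (exists2 x, P x & \sum_(i in S) x 0 i = mu S) /\
    (forall x, P x -> mu S <= \sum_(i in S) x 0 i).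

Definition MV_polytope P : Prop :=
  lattice_generalized_permutahedron P /\
  exists mu, is_supermodular_function P mu /\
    forall (S : {set 'I_n}) (a b c : 'I_n),
      a \notin S -> b \notin S -> c \notin S -> (a < b)%N -> (b < c)%N ->
      mu (b |: S) + mu ([set a; c]%SET :|: S) =
      Num.min (mu (a |: S) + mu ([set b; c]%SET :|: S))
              (mu ([set a; b]%SET :|: S) + mu (c |: S)).

(* The coordinate n + 1 - w^{-1}(i) in one-based indexing. *)
Definition twisted_point (w : 'S_n) : 'rV[R]_n :=
  \row_i (n.+1%:R - ((w^-1)%g i).+1%:R).

Definition twisted_bruhat_interval_polytope (u v : 'S_n) : set 'rV[R]_n :=
  conv_hull [set twisted_point w | w in bruhat_interval u v].

End Polytopes.

Arguments twisted_bruhat_interval_polytope R {n} u v.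

(* Main.v *)
(* Write v = x ∘ u with lengths adding.  Over S, the minimum of the coordinate sum
   on the polytope is mu(S) = sum_{q in Q S} (n - q), where Q S is the Gale-largest
   of the sets w^-1(S), w in [u, v].  The map Q is built along a reduced word of x:
   it starts from Q S = u^-1(S), and a letter s_i replaces Q S by the better of Q S
   and Q (s_i S) when i is in S and i + 1 is not.  On weights this is the tropical
   action of a Chevalley generator, f(S) |-> min(f(S), f(s_i S)), which preserves
   the three-term MV relations (a tropicalized three-term Pluecker relation) and,
   together with them, supermodularity.

   By the tableau criterion w lies in [u, v] iff every set w({1..d}) lies between
   u({1..d}) and v({1..d}) in the Gale order of prefixes, so lower bounds on the
   polytope hold one d at a time.  Conversely, the greedy algorithm along any chain
   of subsets turns Q into a permutation of [u, v] attaining all the minima on the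
   chain.  Two greedy vertices whose chains differ in one set differ by a multiple
   of e_i - e_j, and an edge is crossed by such a step. *)

From Stdlib Require Import Relation_Operators.
Require Import Defs.
From mathcomp Require Import all_boot all_order all_fingroup all_algebra.
From mathcomp Require Import zify.

Set Implicit Arguments.
Unset Strict Implicit.
Unset Printing Implicit Defensive.
Import Order.TTheory GRing.Theory Num.Theory.

(** * Tropical three-term relations among integers *)

Section Numeric.
Local Open Scope ring_scope.

Lemma eq_minP (x y z : int) :
  x = Num.min y z -> [/\ x <= y, x <= z & x = y \/ x = z].
Proof. by move=> ->; split; lia. Qed.

Lemma le_min_sum (a b c d t : int) :
  t <= a + c -> t <= a + d -> t <= b + c -> t <= b + d ->
  t <= Num.min a b + Num.min c d.
Proof. lia. Qed.

(** Phrased by contradiction so that every minimum disappears and only inequalities between plain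
    sums remain for linear arithmetic. *)
Lemma min_sum_le (a b c d t : int) :
  (t < a + c -> t < a + d -> t < b + c -> t < b + d -> False) ->
  Num.min a b + Num.min c d <= t.
Proof. lia. Qed.

Lemma min_min_sum_le (a b c d a' b' c' d' t : int) :
  (t < a + c -> t < a + d -> t < b + c -> t < b + d ->
   t < a' + c' -> t < a' + d' -> t < b' + c' -> t < b' + d' -> False) ->
  Num.min (Num.min a b + Num.min c d) (Num.min a' b' + Num.min c' d') <= t.
Proof.
move=> H; rewrite ge_min leNgt -implybE; apply/implyP => lt1.
by apply: min_sum_le => *; apply: H => //; lia.
Qed.

(* The values of f on the 2- and 3-subsets of a five-element set {1, ..., 5}: if
   they satisfy the three-term relations, so do the minima over a pair of
   consecutive elements, here {1, 2} and below {2, 3}. *)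
Variables (x13 x14 x15 x23 x24 x25 x34 x35 x45 x12 : int)
  (x123 x124 x125 x134 x135 x145 x234 x235 x245 x345 : int).

Lemma tropical12 :
  x14 + x135 = Num.min (x13 + x145) (x134 + x15) ->
  x24 + x235 = Num.min (x23 + x245) (x234 + x25) ->
  x23 + x135 = Num.min (x13 + x235) (x123 + x35) ->
  x25 + x135 = Num.min (x15 + x235) (x125 + x35) ->
  x24 + x134 = Num.min (x14 + x234) (x124 + x34) ->
  x23 + x124 = Num.min (x12 + x234) (x123 + x24) ->
  x13 + x124 = Num.min (x12 + x134) (x123 + x14) ->
  x13 + x125 = Num.min (x12 + x135) (x123 + x15) ->
  x24 + x125 = Num.min (x12 + x245) (x124 + x25) ->
  x14 + x125 = Num.min (x12 + x145) (x124 + x15) ->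
  Num.min x14 x24 + Num.min x135 x235 =
  Num.min (Num.min x13 x23 + Num.min x145 x245)
          (Num.min x134 x234 + Num.min x15 x25).
Proof.
move=> /eq_minP[a1 a2 a3] /eq_minP[b1 b2 b3] /eq_minP[c1 _ _] /eq_minP[d1 _ _].
move=> /eq_minP[e1 _ _] /eq_minP[f1 f2 f3] /eq_minP[g1 g2 g3].
move=> /eq_minP[h1 h2 h3] /eq_minP[i1 i2 i3] /eq_minP[j1 j2 j3].
apply/eqP; rewrite eq_le; apply/andP; split.
  rewrite le_min; apply/andP; split; apply: le_min_sum; apply: min_sum_le.
  - clear -a1; lia.
  - clear -b1 c1; lia.
  - clear -f3 a1 g1 e1 g2; case: f3; lia.
  - clear -b1; lia.
  - clear -a2; lia.
  - clear -h3 g1 i2 g2 a2; case: h3; lia.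
  - clear -a2 e1; lia.
  - clear -b2; lia.
(* For the reverse inequality all eight sums are assumed to exceed one of the four right-hand sums.
   The hypotheses then say which argument attains each minimum, and every alternative is
   contradictory. *)
apply: le_min_sum; apply: min_min_sum_le.
- clear -a3; case: a3; lia.
- clear -a3 c1 d1; case: a3; lia.
- clear -i3 h1 g3 j3 f2 a3 h2; case: i3; [lia|]; case: g3; [lia|].
  by case: j3; [lia|]; case: a3; lia.
- clear -b3; case: b3; lia.
Qed.

Lemma tropical23 :
  x24 + x125 = Num.min (x12 + x245) (x124 + x25) ->
  x34 + x135 = Num.min (x13 + x345) (x134 + x35) ->
  x13 + x124 = Num.min (x12 + x134) (x123 + x14) ->
  x24 + x134 = Num.min (x14 + x234) (x124 + x34) ->
  x23 + x135 = Num.min (x13 + x235) (x123 + x35) ->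
  x24 + x235 = Num.min (x23 + x245) (x234 + x25) ->
  x13 + x125 = Num.min (x12 + x135) (x123 + x15) ->
  x14 + x135 = Num.min (x13 + x145) (x134 + x15) ->
  x24 + x145 = Num.min (x14 + x245) (x124 + x45) ->
  x35 + x145 = Num.min (x15 + x345) (x135 + x45) ->
  x14 + x125 = Num.min (x12 + x145) (x124 + x15) ->
  Num.min x24 x34 + Num.min x125 x135 =
  Num.min (Num.min x12 x13 + Num.min x245 x345)
          (Num.min x124 x134 + Num.min x25 x35).
Proof.
move=> /eq_minP[a1 a2 a3] /eq_minP[b1 b2 b3] /eq_minP[c1 c2 c3] /eq_minP[d1 d2 _].
move=> /eq_minP[e1 _ _] /eq_minP[f1 f2 f3] /eq_minP[g1 g2 g3].
move=> /eq_minP[h1 h2 h3] /eq_minP[i1 i2 i3] /eq_minP[j1 j2 j3] /eq_minP[k1 k2 k3].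
apply/eqP; rewrite eq_le; apply/andP; split.
  rewrite le_min; apply/andP; split; apply: le_min_sum; apply: min_sum_le.
  - clear -a1; lia.
  - clear -c1 b1 d2; lia.
  - clear -e1 f1; lia.
  - clear -b1; lia.
  - clear -a2; lia.
  - clear -d2 b2; lia.
  - clear -g3 c1 a2 c2 h2; case: g3; lia.
  - clear -b2; lia.
apply: le_min_sum; apply: min_min_sum_le.
- clear -a3; case: a3; lia.
- clear -h3 i3 j2 a3 g1 k2; case: h3.
    by case: i3; lia.
  by case: a3; lia.
- clear -a3 c1 d2; case: a3; lia.
- clear -b3; case: b3; lia.
Qed.

End Numeric.

(** * The MV relations and minima over a pair of consecutive elements *)

Section MinAction.
Variable n : nat.
Implicit Types (f : {set 'I_n} -> int) (S : {set 'I_n}) (i j a b c : 'I_n).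
Local Open Scope ring_scope.

(** Stated for a single triple without any order on [a], [b], [c], so that the symmetry exchanging
    [a] and [c] is available. *)
Definition mv3 f a b c := forall S, a \notin S -> b \notin S -> c \notin S ->
  f (b |: S) + f (a |: (c |: S)) =
  Num.min (f (a |: S) + f (b |: (c |: S))) (f (a |: (b |: S)) + f (c |: S)).

Definition mv f := forall a b c, (a < b)%N -> (b < c)%N -> mv3 f a b c.

Definition supermodular f := forall S a b,
  a \notin S -> b \notin S -> a != b ->
  f (a |: S) + f (b |: S) <= f S + f (a |: (b |: S)).

(* The tropical action of a Chevalley generator; used with j = i + 1. *)
Definition min_act i j f S : int :=
  if (i \in S) && (j \notin S) then Num.min (f S) (f (j |: S :\ i)) else f S.

Lemma setU1CA a b S : a |: (b |: S) = b |: (a |: S).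
Proof. exact: setUCA. Qed.

(** The exchange of [a] and [c] only swaps the two arguments of the minimum. It amounts to reversing
    the ground set. *)
Lemma mv3C f a b c : mv3 f a b c -> mv3 f c b a.
Proof.
move=> H S cS bS aS; have := H S aS bS cS.
by rewrite (setU1CA c a) (setU1CA b a) (setU1CA c b); lia.
Qed.

Lemma min_act1 i j f S : i \notin S -> j \notin S -> i != j ->
  min_act i j f (i |: S) = Num.min (f (i |: S)) (f (j |: S)).
Proof.
by move=> iS jS ij; rewrite /min_act !inE eqxx /= negb_or eq_sym ij jS setU1K.
Qed.

Lemma min_actN i j f S : i \notin S -> min_act i j f S = f S.
Proof. by move=> iS; rewrite /min_act (negPf iS). Qed.

Lemma min_actT i j f S : j \in S -> min_act i j f S = f S.
Proof. by move=> jS; rewrite /min_act jS andbF. Qed.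

Section PairMin.
Variables (f : {set 'I_n} -> int) (S : {set 'I_n}) (e1 e2 e3 e4 e5 : 'I_n).
Hypotheses (n1 : e1 \notin S) (n2 : e2 \notin S) (n3 : e3 \notin S)
  (n4 : e4 \notin S) (n5 : e5 \notin S) (De : uniq [:: e1; e2; e3; e4; e5]).
Local Notation m i j S := (Num.min (f (i |: S)) (f (j |: S))).

Ltac sort5 := rewrite ?(setU1CA e2 e1, setU1CA e3 e1, setU1CA e4 e1, setU1CA e5 e1,
  setU1CA e3 e2, setU1CA e4 e2, setU1CA e5 e2, setU1CA e4 e3,
  setU1CA e5 e3, setU1CA e5 e4).

Ltac inst H e := let U := fresh in
  have U := H (e |: S); move: U; rewrite !inE !negb_or; sort5; apply;
  by rewrite ?n1 ?n2 ?n3 ?n4 ?n5 andbT // eq_sym.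

Ltac distinct := move: De; rewrite /= !inE !negb_or;
  move=> /and5P[/and4P[? ? ? ?] /and3P[? ? ?] /andP[? ?] ? _].

(** This is [tropical12] with x_A = f(A ∪ S): each of its ten hypotheses is the relation of one
    triple over S enlarged by one of the two remaining elements. *)
Lemma mv3_pair_min12 :
  mv3 f e1 e2 e3 -> mv3 f e1 e2 e4 -> mv3 f e1 e2 e5 ->
  mv3 f e1 e3 e4 -> mv3 f e1 e3 e5 -> mv3 f e1 e4 e5 ->
  mv3 f e2 e3 e4 -> mv3 f e2 e3 e5 -> mv3 f e2 e4 e5 -> mv3 f e3 e4 e5 ->
  m e1 e2 (e4 |: S) + m e1 e2 (e3 |: (e5 |: S)) =
  Num.min (m e1 e2 (e3 |: S) + m e1 e2 (e4 |: (e5 |: S)))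
          (m e1 e2 (e3 |: (e4 |: S)) + m e1 e2 (e5 |: S)).
Proof.
distinct => h123 h124 h125 h134 h135 h145 h234 h235 h245 h345.
apply: (tropical12 (x35 := f (e3 |: (e5 |: S))) (x34 := f (e3 |: (e4 |: S)))
  (x12 := f (e1 |: (e2 |: S))) (x123 := f (e1 |: (e2 |: (e3 |: S))))
  (x124 := f (e1 |: (e2 |: (e4 |: S)))) (x125 := f (e1 |: (e2 |: (e5 |: S))))).
- inst h345 e1.
- inst h345 e2.
- inst h125 e3.
- inst h123 e5.
- inst h123 e4.
- inst h134 e2.
- inst h234 e1.
- inst h235 e1.
- inst h145 e2.
- inst h245 e1.
Qed.

Lemma mv3_pair_min23 :
  mv3 f e1 e2 e3 -> mv3 f e1 e2 e4 -> mv3 f e1 e2 e5 ->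
  mv3 f e1 e3 e4 -> mv3 f e1 e3 e5 -> mv3 f e1 e4 e5 ->
  mv3 f e2 e3 e4 -> mv3 f e2 e3 e5 -> mv3 f e2 e4 e5 -> mv3 f e3 e4 e5 ->
  m e2 e3 (e4 |: S) + m e2 e3 (e1 |: (e5 |: S)) =
  Num.min (m e2 e3 (e1 |: S) + m e2 e3 (e4 |: (e5 |: S)))
          (m e2 e3 (e1 |: (e4 |: S)) + m e2 e3 (e5 |: S)).
Proof.
distinct => h123 h124 h125 h134 h135 h145 h234 h235 h245 h345; sort5.
apply: (tropical23 (x14 := f (e1 |: (e4 |: S))) (x15 := f (e1 |: (e5 |: S)))
  (x23 := f (e2 |: (e3 |: S))) (x45 := f (e4 |: (e5 |: S)))
  (x123 := f (e1 |: (e2 |: (e3 |: S)))) (x145 := f (e1 |: (e4 |: (e5 |: S))))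
  (x234 := f (e2 |: (e3 |: (e4 |: S)))) (x235 := f (e2 |: (e3 |: (e5 |: S))))).
- inst h145 e2.
- inst h145 e3.
- inst h234 e1.
- inst h123 e4.
- inst h125 e3.
- inst h345 e2.
- inst h235 e1.
- inst h345 e1.
- inst h125 e4.
- inst h134 e5.
- inst h245 e1.
Qed.
End PairMin.

(** Nothing lies strictly between i and i + 1, so in the sorted five-element set they occupy places
    12, 23, 34 or 45. The last two cases are the mirror images of the first two under [mv3C]. *)
Lemma mv_pair_min i j f S a b c : j = i.+1 :> nat -> mv f ->
  (a < b)%N -> (b < c)%N -> uniq [:: i; j; a; b; c] ->
  all [pred e | e \notin S] [:: i; j; a; b; c] ->
  let m S := Num.min (f (i |: S)) (f (j |: S)) in
  m (b |: S) + m (a |: (c |: S)) =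
  Num.min (m (a |: S) + m (b |: (c |: S))) (m (a |: (b |: S)) + m (c |: S)).
Proof.
move=> ji Mf ab bc D /= /and5P[iS jS aS bS /andP[cS _]].
have nE (x y : 'I_n) : x != y -> x <> y :> nat by move=> /eqP xy /val_inj.
move: (D); rewrite /= !inE !negb_or.
move=> /and5P[/and4P[_ ia ib ic] /and3P[ja jb jc] _ _ _].
move/nE: ia => ia; move/nE: ib => ib; move/nE: ic => ic.
move/nE: ja => ja; move/nE: jb => jb; move/nE: jc => jc.
have [ltia|leai] := ltnP i a.
  by apply: mv3_pair_min12 => //; apply: Mf => //; clear -ltia ja ji ab bc; lia.
have [ltib|lebi] := ltnP i b.
  apply: mv3_pair_min23 => //; last first.
  1-10: by apply: Mf => //; clear -leai ltib ia jb ji ab bc; lia.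
  by rewrite (perm_uniq (_ : perm_eq _ [:: i; j; a; b; c])) //;
    apply/seq.permP => p /=; lia.
have mE S' : Num.min (f (j |: S')) (f (i |: S')) = Num.min (f (i |: S')) (f (j |: S')).
  by rewrite minC.
have [ltic|leci] := ltnP i c.
  have := @mv3_pair_min23 f S c j i b a;
  rewrite !mE (setU1CA c a) (setU1CA b a) (setU1CA c b).
  rewrite [RHS]minC [X in _ = Num.min X _]addrC [X in _ = Num.min _ X]addrC.
  apply=> //; last first.
  1-10: by apply: mv3C; apply: Mf => //; clear -lebi ltic ib jc ji ab bc; lia.
  by rewrite (perm_uniq (_ : perm_eq _ [:: i; j; a; b; c])) //;
    apply/seq.permP => p /=; lia.
have := @mv3_pair_min12 f S j i c b a;
rewrite !mE (setU1CA c a) (setU1CA b a) (setU1CA c b).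
rewrite [RHS]minC [X in _ = Num.min X _]addrC [X in _ = Num.min _ X]addrC.
  apply=> //; last first.
1-10: by apply: mv3C; apply: Mf => //; clear -leci ic ji ab bc; lia.
by rewrite (perm_uniq (_ : perm_eq _ [:: i; j; a; b; c])) //;
    apply/seq.permP => p /=; lia.
Qed.

End MinAction.

(** * The Chevalley action preserves the MV relations and supermodularity *)

Section MinActionPreserves.
Variable n : nat.
Implicit Types (f : {set 'I_n} -> int) (S : {set 'I_n}) (i j a b c : 'I_n).
Local Open Scope ring_scope.

Ltac mem := rewrite ?inE ?eqxx;
  repeat match goal with H : is_true (_ \in _) |- _ => rewrite H end;
  by rewrite ?orbT //= ?negb_or;
  do ?[apply/andP; split] => //; rewrite 1?eq_sym.

Ltac eval_min_act := repeat match goal with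
  |- context [min_act ?i ?j ?f ?X] =>
    first [ rewrite (@min_actT _ i j f X ltac:(mem))
          | rewrite (@min_actN _ i j f X ltac:(mem))
          | match X with i |: ?Y =>
              rewrite (@min_act1 _ i j f Y ltac:(mem) ltac:(mem) ltac:(mem)) end ]
  end.

Ltac sort4 i j a b := rewrite ?(setU1CA j i, setU1CA a i, setU1CA b i,
  setU1CA a j, setU1CA b j, setU1CA b a).

Ltac inst_at H S i j a b := let U := fresh in
  have U := H S ltac:(mem) ltac:(mem) ltac:(mem); move: U; sort4 i j a b; apply.

Ltac nlia := repeat match goal with
    H : mv _ |- _ => clear H
  | H : mv3 _ _ _ _ |- _ => clear H
  | H : is_true (_ \notin _) |- _ => clear H | H : _ = _ |: _ |- _ => clear H end; lia.

Lemma min_eq_minn (l1 l2 r1 r2 s1 s2 : int) :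
  l1 = Num.min r1 s1 -> l2 = Num.min r2 s2 ->
  Num.min l1 l2 = Num.min (Num.min r1 r2) (Num.min s1 s2).
Proof. by move=> -> ->; rewrite minACA. Qed.

(** The cases are the positions of i and j relative to S and the triple. If the action changes none
    of the sets involved, the old relation remains. If i lies in S and j in the triple, or i in the
    triple and j outside it and S, the new relation is the minimum of two old ones, obtained by
    exchanging i and j. If i is in S and j is outside both, [mv_pair_min] applies. *)
Lemma mv_min_act i j f : j = i.+1 :> nat -> mv f -> mv (min_act i j f).
Proof.
move=> ji Mf a b c ab bc S aS bS cS.
have neqN (x y : 'I_n) : x != y -> x != y :> nat by [].
have ij : i != j by apply/eqP => e; move: ji; rewrite e; lia.
have Dab : a != b by apply/eqP => e; move: ab; rewrite e; lia.
have Dbc : b != c by apply/eqP => e; move: bc; rewrite e; lia.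
have Dac : a != c by apply/eqP => e; move: bc; rewrite -e; lia.
have [jS|jS] := boolP (j \in S); first by eval_min_act; apply: Mf.
have [iS|iS] := boolP (i \in S).
  have [ia ib ic] : [/\ i != a, i != b & i != c].
    by split; apply/eqP => e; move: aS bS cS; rewrite -e iS.
  have [iaN ibN icN] := And3 (neqN _ _ ia) (neqN _ _ ib) (neqN _ _ ic).
  have {iS}[S0 [iS0 ES]] : exists S0 : {set 'I_n}, i \notin S0 /\ S = i |: S0.
    by exists (S :\ i); rewrite ?setD1K // !inE eqxx.
  move: aS bS cS jS; rewrite ES !inE !negb_or.
  move=> /andP[_ aS] /andP[_ bS] /andP[_ cS] /andP[_ jS].
  have [ja|ja] := eqVneq j a.
    subst a; sort4 i j b c; eval_min_act; sort4 i j b c.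
    have H1 : mv3 f j b c by apply: Mf.
    have H2 : mv3 f i b c by apply: Mf => //; nlia.
    rewrite ?addr_minl ?addr_minr.
    by apply: min_eq_minn; [inst_at H1 (i |: S0) i j b c | inst_at H2 (j |: S0) i j b c].
  have [jb|jb] := eqVneq j b.
    subst b; sort4 i j a c; eval_min_act; sort4 i j a c.
    have H1 : mv3 f a j c by apply: Mf.
    have H2 : mv3 f a i c by apply: Mf => //; nlia.
    rewrite ?addr_minl ?addr_minr.
    by apply: min_eq_minn; [inst_at H1 (i |: S0) i j a c | inst_at H2 (j |: S0) i j a c].
  have [jc|jc] := eqVneq j c.
    subst c; sort4 i j a b; eval_min_act; sort4 i j a b.
    have H1 : mv3 f a b j by apply: Mf.
    have H2 : mv3 f a b i by apply: Mf => //; nlia.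
    rewrite ?addr_minl ?addr_minr.
    by apply: min_eq_minn; [inst_at H1 (i |: S0) i j a b | inst_at H2 (j |: S0) i j a b].
  have [jaN jbN jcN] := And3 (neqN _ _ ja) (neqN _ _ jb) (neqN _ _ jc).
  rewrite !(setU1CA _ i); eval_min_act.
  apply: mv_pair_min => //; last by rewrite /= iS0 jS aS bS cS.
  by rewrite /= !inE !negb_or ij ia ib ic ja jb jc Dab Dac Dbc.
have [ia|ia] := eqVneq i a.
  subst a; have [jb|jb] := eqVneq j b.
    subst b; sort4 i j c c; eval_min_act; sort4 i j c c.
    have := Mf i j c ab bc S ltac:(mem) ltac:(mem) ltac:(mem); sort4 i j c c.
    (* With both i and j in the triple, the two sides of the old relation gain the same extra term
       under the minimum. *)
    by rewrite addr_minl addr_minr => ->; rewrite minAC.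
  have jbN := neqN _ _ jb.
  have jc : j != c by apply/eqP => e; move: bc; rewrite -e; lia.
  eval_min_act.
  have H1 : mv3 f i b c by apply: Mf.
  have H2 : mv3 f j b c by apply: Mf => //; nlia.
  rewrite ?addr_minl ?addr_minr.
  by apply: min_eq_minn; [inst_at H1 S i j b c | inst_at H2 S i j b c].
have [ib|ib] := eqVneq i b.
  subst b; have [jc|jc] := eqVneq j c.
    subst c; sort4 i j a a; eval_min_act; sort4 i j a a.
    have := Mf a i j ab bc S ltac:(mem) ltac:(mem) ltac:(mem); sort4 i j a a.
    by rewrite !addr_minl => ->; rewrite -minA [f (j |: S) + _]addrC.
  have jcN := neqN _ _ jc.
  have ja : j != a by apply/eqP => e; move: ab; rewrite -e; lia.
  sort4 i j a c; eval_min_act; sort4 i j a c.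
  have H1 : mv3 f a i c by apply: Mf.
  have H2 : mv3 f a j c by apply: Mf => //; nlia.
  rewrite ?addr_minl ?addr_minr.
  by apply: min_eq_minn; [inst_at H1 S i j a c | inst_at H2 S i j a c].
have [ic|ic] := eqVneq i c.
  subst c.
  have ja : j != a by apply/eqP => e; move: ab; rewrite -e; lia.
  have jb : j != b by apply/eqP => e; move: ab bc; rewrite -e; lia.
  sort4 i j a b; eval_min_act; sort4 i j a b.
  have H1 : mv3 f a b i by apply: Mf.
  have H2 : mv3 f a b j by apply: Mf => //; nlia.
  rewrite ?addr_minl ?addr_minr.
  by apply: min_eq_minn; [inst_at H1 S i j a b | inst_at H2 S i j a b].
by eval_min_act; apply: Mf.
Qed.

Lemma mv3_le f a b c S : mv3 f a b c ->
  a \notin S -> b \notin S -> c \notin S ->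
  f (b |: S) + f (a |: (c |: S)) <= f (a |: S) + f (b |: (c |: S)) /\
  f (b |: S) + f (a |: (c |: S)) <= f (a |: (b |: S)) + f (c |: S).
Proof. by move=> M aS bS cS; rewrite M // !ge_min !lexx orbT. Qed.

Ltac sort_four a b c d := rewrite ?(setU1CA b a, setU1CA c a, setU1CA d a,
  setU1CA c b, setU1CA d b, setU1CA d c).

(** On the right, sums that use the same element of the pair twice are bounded by supermodularity
    over that element. The mixed sums also need the inequalities contained in the MV relations,
    which trade [a] for [b]. *)
Lemma supermodular_pair_min_left f S a b c d : supermodular f ->
  mv3 f a b c -> mv3 f b c d ->
  uniq [:: a; b; c; d] -> all [pred e | e \notin S] [:: a; b; c; d] ->
  let m S := Num.min (f (a |: S)) (f (b |: S)) in
  m (c |: S) + m (d |: S) <= m S + m (c |: (d |: S)).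
Proof.
move=> SM M1 M2; rewrite /= !inE !negb_or.
move=> /and4P[/and3P[ab ac ad] /andP[bc bd] cd _] /and5P[aS bS cS dS _].
have [] := mv3_le (S := d |: S) M1 ltac:(mem) ltac:(mem) ltac:(mem).
have [] := mv3_le (S := a |: S) M2 ltac:(mem) ltac:(mem) ltac:(mem).
have := SM (a |: S) b d ltac:(mem) ltac:(mem) ltac:(mem).
have := SM (b |: S) a d ltac:(mem) ltac:(mem) ltac:(mem).
have := SM (a |: S) c d ltac:(mem) ltac:(mem) ltac:(mem).
have := SM (b |: S) c d ltac:(mem) ltac:(mem) ltac:(mem).
sort_four a b c d => h1 h2 h3 h4 h5 h6 h7 h8.
apply: le_min_sum; apply: min_sum_le; clear -h1 h2 h3 h4 h5 h6 h7 h8; lia.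
Qed.

Lemma supermodular_pair_min_mid f S a b c d : supermodular f ->
  mv3 f a b c -> mv3 f b c d ->
  uniq [:: a; b; c; d] -> all [pred e | e \notin S] [:: a; b; c; d] ->
  let m S := Num.min (f (b |: S)) (f (c |: S)) in
  m (a |: S) + m (d |: S) <= m S + m (a |: (d |: S)).
Proof.
move=> SM M1 M2; rewrite /= !inE !negb_or.
move=> /and4P[/and3P[ab ac ad] /andP[bc bd] cd _] /and5P[aS bS cS dS _].
have [] := mv3_le (S := d |: S) M1 ltac:(mem) ltac:(mem) ltac:(mem).
have [] := mv3_le (S := a |: S) M2 ltac:(mem) ltac:(mem) ltac:(mem).
have := SM (b |: S) a d ltac:(mem) ltac:(mem) ltac:(mem).
have := SM (c |: S) a d ltac:(mem) ltac:(mem) ltac:(mem).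
sort_four a b c d => h3 h4 h5 h6 h7 h8.
apply: le_min_sum; apply: min_sum_le; clear -h3 h4 h5 h6 h7 h8; lia.
Qed.

Lemma supermodular_min_act i j f : j = i.+1 :> nat ->
  mv f -> supermodular f -> supermodular (min_act i j f).
Proof.
move=> ji Mf SMf S a b aS bS ab.
have ij : i != j by apply/eqP => e; move: ji; rewrite e; lia.
(* The claim is symmetric in a and b. Ranking i first, j second and the rest in their own order
   fixes which of a, b is treated first. *)
pose r (x : 'I_n) := if x == i then 0%N else if x == j then 1%N else x.+2.
wlog rab : a b aS bS ab / (r a <= r b)%N.
  move=> H; have [/H|/ltnW/H] := leqP (r a) (r b); first exact.
  by rewrite addrC (setU1CA b a) eq_sym; apply.
have [jS|jS] := boolP (j \in S); first by eval_min_act; apply: SMf.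
have [iS|iS] := boolP (i \in S).
  have [ia ib] : i != a /\ i != b.
    by split; apply/eqP => e; move: aS bS; rewrite -e iS.
  have {iS}[S0 [iS0 ES]] : exists S0 : {set 'I_n}, i \notin S0 /\ S = i |: S0.
    by exists (S :\ i); rewrite ?setD1K // !inE eqxx.
  move: aS bS jS; rewrite ES !inE !negb_or.
  move=> /andP[_ aS] /andP[_ bS] /andP[_ jS].
  have [ja|ja] := eqVneq j a.
    subst a; sort4 i j b b; eval_min_act; sort4 i j b b.
    have := SMf (i |: S0) j b ltac:(mem) ltac:(mem) ltac:(mem).
    have := SMf (j |: S0) i b ltac:(mem) ltac:(mem) ltac:(mem).
    sort4 i j b b => h1 h2; clear -h1 h2; lia.
  have jb : j != b.
    apply/eqP => e; move: rab; rewrite /r -e eqxx ![_ == i]eq_sym (negPf ij).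
    by rewrite (negPf ia) eq_sym (negPf ja).
  have ltab : (a < b)%N.
    move: rab; rewrite /r ![_ == i]eq_sym (negPf ia) (negPf ib).
    rewrite ![_ == j]eq_sym (negPf ja) (negPf jb) !ltnS leq_eqVlt.
    by rewrite (inj_eq val_inj) (negPf ab).
  rewrite !(setU1CA _ i); eval_min_act.
  have nE (x y : 'I_n) : x != y -> x <> y :> nat by move=> /eqP xy /val_inj.
  have [iaN ibN jaN jbN] := And4 (nE _ _ ia) (nE _ _ ib) (nE _ _ ja) (nE _ _ jb).
  have [ltia|leai] := ltnP i a.
    apply: supermodular_pair_min_left => //.
    - by apply: Mf; [rewrite ji | clear -ltia ja jaN ji; lia].
    - by apply: Mf => //; clear -ltia jaN ji; lia.
    - by rewrite /= !inE !negb_or ij ia ib ja jb ab.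
    - by rewrite /= iS0 jS aS bS.
  have [ltib|lebi] := ltnP i b.
    apply: supermodular_pair_min_mid => //.
    - by apply: Mf; clear -leai iaN ji; lia.
    - by apply: Mf => //; clear -ltib jbN ji; lia.
    - by rewrite /= !inE !negb_or ij ib ![a == _]eq_sym ia ja jb eq_sym ab.
    - by rewrite /= iS0 jS aS bS.
  have := @supermodular_pair_min_left f S0 j i b a SMf.
  rewrite /= !(minC (f (j |: _))) addrC (setU1CA b a); apply.
  - by apply: mv3C; apply: Mf => //; clear -lebi ibN ji; lia.
  - by apply: mv3C; apply: Mf => //; clear -lebi ibN ji; lia.
  - by rewrite /= !inE !negb_or (eq_sym j i) ij ib ia ja jb eq_sym ab.
  - by rewrite /= iS0 jS aS bS.
have [ia|ia] := eqVneq i a.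
  subst a; have [jb|jb] := eqVneq j b.
    subst b; eval_min_act.
    have := SMf S i j ltac:(mem) ltac:(mem) ltac:(mem).
    by move=> h1; clear -h1; lia.
  eval_min_act.
  have := SMf S i b ltac:(mem) ltac:(mem) ltac:(mem).
  have := SMf S j b ltac:(mem) ltac:(mem) ltac:(mem).
  by move=> h1 h2; clear -h1 h2; lia.
have ib : i != b.
  apply/eqP => e; move: rab; rewrite /r -e eqxx eq_sym (negPf ia).
  by case: ifP.
by eval_min_act; apply: SMf.
Qed.

End MinActionPreserves.

(** * The Gale order through heights, and its behaviour under an adjacent swap *)

Section Heights.
Variable n : nat.
Implicit Types (I K L S V X : {set 'I_n}) (i j : 'I_n) (d m : nat).

(* The Gale order on sets of equal size is the pointwise order of heights. *)
Definition height I m := #|I :&: [set x : 'I_n | m <= x]|.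

Definition count_below X d := #|X :&: [set x : 'I_n | x < d]|.

Lemma card_setU1I (a : 'I_n) X S : a \notin X ->
  #|(a |: X) :&: S| = (a \in S) + #|X :&: S|.
Proof.
move=> aX; rewrite setIUl; have [aS|aS] := boolP (a \in S).
  by rewrite (setIidPl _) ?sub1set // cardsU1 !inE negb_and aX.
have -> : [set a] :&: S = set0.
  by apply/setP => x; rewrite !inE; case: eqP => // ->; rewrite (negPf aS).
by rewrite set0U.
Qed.

Lemma card_setD1I (a : 'I_n) X S : a \in X ->
  #|X :&: S| = (a \in S) + #|(X :\ a) :&: S|.
Proof. by move=> aX; rewrite -{1}(setD1K aX) card_setU1I // !inE eqxx. Qed.

Lemma card_swapI i j X S : i \in X -> j \notin X ->
  (i \in S) + #|(j |: X :\ i) :&: S| = (j \in S) + #|X :&: S|.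
Proof.
move=> iX jX; rewrite (card_setD1I S iX) card_setU1I; first by rewrite addnCA.
by rewrite !inE negb_and jX orbT.
Qed.

Lemma height_swap i j X m : j = i.+1 :> nat -> i \in X -> j \notin X ->
  height (j |: X :\ i) m = height X m + (m == j).
Proof.
move=> ji iX jX; have := card_swapI [set x : 'I_n | m <= x] iX jX.
by rewrite !in_set -!/(height _ _) ji; lia.
Qed.

Lemma heightS i X : height X i = (i \in X) + height X i.+1.
Proof.
rewrite /height [LHS](_ : _ = #|[set x in X | i <= x]|); last first.
  by apply: eq_card => x; rewrite !inE.
rewrite (cardsD1 i) inE leqnn andbT; congr (_ + _); apply: eq_card => x.
by rewrite !inE ltn_neqAle andbCA (eq_sym x i).
Qed.

Lemma swapK i j X : i \in X -> j \notin X -> i != j ->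
  i |: (j |: X :\ i) :\ j = X.
Proof.
move=> iX jX ij; rewrite setU1K ?setD1K //.
by rewrite !inE negb_and jX orbT.
Qed.

Lemma tperm_imset_id i j X : (i \in X) = (j \in X) -> tperm i j @: X = X.
Proof.
move=> ij; apply/setP => x; rewrite -{1}[x](tpermK i j) (mem_imset _ _ perm_inj).
by case: tpermP => // ->.
Qed.

Lemma tperm_imset_swap i j X : i \in X -> j \notin X ->
  tperm i j @: X = j |: X :\ i.
Proof.
move=> iX jX; apply/setP => x; rewrite -{1}[x](tpermK i j) (mem_imset _ _ perm_inj).
have ij : i != j by apply: contraNneq jX => <-.
rewrite !inE; case: tpermP => [->|->|/eqP xi /eqP xj].
- by rewrite eqxx (negPf jX) (negPf ij).
- by rewrite eqxx iX.
- by rewrite (negPf xi) (negPf xj).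
Qed.

(** The swap must raise V, and it does so at the threshold j only. An I below the swapped set but
    not below V therefore exceeds V exactly there, which forces j into I and i out of it; replacing
    j by i removes the excess. *)
Lemma height_le_swap i j V I m0 : j = i.+1 :> nat ->
  (forall m, height I m <= height (tperm i j @: V) m) ->
  height V m0 < height I m0 ->
  [/\ j \in I, i \notin I & forall m, height (i |: I :\ j) m <= height V m].
Proof.
move=> ji leI lt0.
have ij : i != j by apply/eqP => e; move: ji; rewrite e; lia.
have [VE|] := eqVneq (i \in V) (j \in V).
  by move: (leI m0); rewrite tperm_imset_id // leqNgt lt0.
have [iV|iV] := boolP (i \in V); last first.
  case: (boolP (j \in V)) => // jV _; move: (leI m0).
  rewrite tpermC tperm_imset_swap //.
  have := height_swap m0 (i := i) (j := j) (X := i |: V :\ j) ji.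
  rewrite swapK // ?(eq_sym j i) // !inE !eqxx (eq_sym j i) (negPf ij) (negPf iV) => /(_ isT isT).
  by move: lt0; lia.
case: (boolP (j \in V)) => // jV _.
have leI' m : height I m <= height V m + (m == j).
  by rewrite -(height_swap _ ji iV jV) -tperm_imset_swap.
have m0j : m0 = j :> nat.
  by apply/eqP; apply: contraTT lt0 => /negPf e; rewrite -leqNgt (leq_trans (leI' _)) // e addn0.
move: lt0; rewrite m0j => lt0.
have := heightS j I; have := heightS j V; have := heightS i I; have := heightS i V.
rewrite -ji iV (negPf jV) => Vi Ii Vj Ij.
have leIi := leI' i; have leIj1 := leI' j.+1.
have jI : j \in I.
  apply: contraTT lt0 => /negPf e; rewrite -leqNgt Ij e Vj.
  by move: leIj1; lia.
have iI : i \notin I.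
  by apply/negP => e; move: Ii leIi lt0; rewrite e Vi ji; lia.
split=> // m; have := height_swap m (i := i) (j := j) (X := i |: I :\ j) ji.
rewrite swapK // ?(eq_sym j i) // !inE !eqxx (eq_sym j i) (negPf ij) (negPf iI) => /(_ isT isT).
by have := leI' m; lia.
Qed.

End Heights.

(** * Nonincreasing weights on positions *)

Section Weights.
Variable n : nat.
Implicit Types (X : {set 'I_n}) (p q : 'I_n).
Local Open Scope ring_scope.

Definition weight (lam : 'I_n -> int) X : int := \sum_(q in X) lam q.

Definition nonincreasing (lam : 'I_n -> int) :=
  forall p q, (p <= q)%N -> lam q <= lam p.

Lemma weightU1 lam p X : p \notin X -> weight lam (p |: X) = lam p + weight lam X.
Proof. by move=> pX; rewrite /weight big_setU1. Qed.

(** One level of the Gale order on positions. Summing [threshold d] over d = 1, ..., n gives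
    [rank_weight], so bounds proved for each d add up to bounds on coordinate sums. *)
Definition threshold (d : nat) (q : 'I_n) : int := ((q < d)%N : nat)%:Z.

Lemma threshold_nonincreasing d : nonincreasing (threshold d).
Proof. by move=> p q pq; rewrite /threshold; lia. Qed.

Lemma weight_threshold d X : weight (threshold d) X = (count_below X d)%:Z.
Proof.
rewrite /weight /count_below -sum1_card raddf_sum /=.
under [RHS]eq_bigl => q do rewrite !inE.
by rewrite big_mkcondr; apply: eq_bigr => q _; rewrite /threshold; case: ifP.
Qed.

(** The value n + 1 - (q + 1) that a twisted point takes at the image of the zero-based position q.
    It is strictly decreasing, so equal weights mean equal positions. *)
Definition rank_weight (q : 'I_n) : int := (n - q)%N%:Z.

Lemma rank_weight_nonincreasing : nonincreasing rank_weight.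
Proof. by move=> p q pq; rewrite /rank_weight; lia. Qed.

Lemma rank_weight_lt p q : (rank_weight p < rank_weight q) = (q < p)%N.
Proof. by rewrite /rank_weight; have := ltn_ord p; have := ltn_ord q; lia. Qed.

End Weights.

(** * Selections: the Gale-optimal sets of positions and their exchange properties *)

Section Selection.
Variable n : nat.
Implicit Types (S I L : {set 'I_n}) (Q : {set 'I_n} -> {set 'I_n}) (u v : 'S_n).

Definition prefix_set v d : {set 'I_n} := v @: [set p : 'I_n | p < d].

(* [sel_bound]: if I lies below v[d] in the Gale order and L is the join of I and
   u[d], then L meets S at least as often as Q predicts.  The join makes the statement
   inductive along the word: without it, undoing a letter may leave the interval.
   For w in [u, v], take I = L = w[d]. *)
Record selection u v Q : Prop := Selection {
  sel_card S : #|Q S| = #|S|;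
  sel_mono S a : Q S \subset Q (a |: S);
  sel_mv lam : nonincreasing lam -> mv (fun S => weight lam (Q S));
  sel_supermodular lam :
    nonincreasing lam -> supermodular (fun S => weight lam (Q S));
  sel_upper m : Q [set x : 'I_n | m <= x] = [set p | m <= u p];
  sel_lower m : Q [set x : 'I_n | x < m] = [set p | v p < m];
  sel_bound d I L S :
    (forall m, height I m <= height (prefix_set v d) m) ->
    (forall m, height L m = maxn (height I m) (height (prefix_set u d) m)) ->
    count_below (Q S) d <= #|L :&: S| }.

Lemma sel_setU1 u v Q S a : selection u v Q -> a \notin S ->
  exists2 p, p \notin Q S & Q (a |: S) = p |: Q S.
Proof.
move=> sQ aS; have sub := sel_mono sQ S a.
have : #|Q (a |: S) :\: Q S| == 1.
  by rewrite cardsDS // !(sel_card sQ) cardsU1 aS addnK.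
move=> /cards1P[p pE]; have : p \in Q (a |: S) :\: Q S by rewrite pE set11.
rewrite inE => /andP[pS _]; exists p => //.
by rewrite -(setID (Q (a |: S)) (Q S)) pE setUC (setIidPr sub).
Qed.

Lemma modular_mv (g : 'I_n -> int) (f : {set 'I_n} -> int) :
  (forall S a, a \notin S -> f (a |: S) = g a + f S)%R -> mv f.
Proof.
move=> fU a b c ab bc S aS bS cS.
have ac : (a < c)%N := ltn_trans ab bc.
have D (x y : 'I_n) : (x < y)%N -> x != y.
  by move=> xy; apply/eqP => e; move: xy; rewrite e ltnn.
by rewrite !fU ?inE ?negb_or ?(D _ _ ab) ?(D _ _ bc) ?(D _ _ ac) //; lia.
Qed.

Lemma modular_supermodular (g : 'I_n -> int) (f : {set 'I_n} -> int) :
  (forall S a, a \notin S -> f (a |: S) = g a + f S)%R -> supermodular f.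
Proof.
by move=> fU S a b aS bS ab; rewrite !fU ?inE ?negb_or ?ab //; lia.
Qed.

Lemma selection_refl u : selection u u (fun S => u @^-1: S).
Proof.
have wU lam S a : a \notin S ->
    weight lam (u @^-1: (a |: S)) = (lam ((u^-1)%g a) + weight lam (u @^-1: S))%R.
  move=> aS; rewrite -weightU1 ?inE ?permKV //; congr weight.
  by apply/setP => p; rewrite !inE (canF_eq (permK u)).
split.
- by move=> S; rewrite on_card_preimset //; exists (u^-1)%g => p _; rewrite ?permK ?permKV.
- by move=> S a; apply: preimsetS; apply: subsetU1.
- by move=> lam _; apply: (modular_mv (wU lam)).
- by move=> lam _; apply: (modular_supermodular (wU lam)).
- by move=> m; apply/setP => p; rewrite !inE.
- by move=> m; apply/setP => p; rewrite !inE.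
- move=> d I L S leI hL.
  (* Since I lies below u[d], the join L has the heights of u[d], and heights determine a set. *)
  have {}hL m : height L m = height (prefix_set u d) m.
    by rewrite hL; apply/maxn_idPr.
  have -> : L = prefix_set u d.
    apply/setP => x; have := heightS x L; rewrite !hL heightS.
    by move/addIn; case: (x \in _); case: (x \in _).
  rewrite /count_below /prefix_set.
  rewrite -(card_imset _ (@perm_inj _ u)) imsetI; last by move=> ? ? _ _; apply: perm_inj.
  rewrite setIC; apply: subset_leq_card; apply: setIS.
  by apply/subsetP => _ /imsetP[p + ->]; rewrite inE.
Qed.

Local Notation rk Q S := (weight (@rank_weight n) (Q S)).

Lemma sel_weight_le u v Q S a b lam : selection u v Q -> nonincreasing lam ->
  a \notin S -> b \notin S -> (rk Q (a |: S) <= rk Q (b |: S))%R ->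
  (weight lam (Q (a |: S)) <= weight lam (Q (b |: S)))%R.
Proof.
move=> sQ lamN aS bS.
have [p pS ->] := sel_setU1 sQ aS; have [q qS ->] := sel_setU1 sQ bS.
rewrite !weightU1 // !lerD2r => pq; apply: lamN.
by rewrite leqNgt -rank_weight_lt -leNgt.
Qed.

Lemma sel_weight_eq u v Q S a b : selection u v Q ->
  a \notin S -> b \notin S -> rk Q (a |: S) = rk Q (b |: S) ->
  Q (a |: S) = Q (b |: S).
Proof.
move=> sQ aS bS.
have [p pS ->] := sel_setU1 sQ aS; have [q qS ->] := sel_setU1 sQ bS.
rewrite !weightU1 // => /addIr pq; suff -> : p = q by [].
have nlt (x y : 'I_n) : rank_weight x = rank_weight y -> x <= y.
  by move=> xy; rewrite leqNgt -rank_weight_lt xy ltxx.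
by apply/val_inj/eqP; rewrite eqn_leq !nlt.
Qed.

Lemma sel_two u v Q S a b p q : selection u v Q ->
  a \notin S -> b \notin S -> a != b ->
  Q (a |: S) = p |: Q S -> Q (b |: S) = q |: Q S ->
  p \notin Q S -> q \notin Q S -> p != q ->
  Q (a |: (b |: S)) = p |: (q |: Q S).
Proof.
move=> sQ aS bS ab Qa Qb pS qS pq.
apply/esym/eqP; rewrite eqEcard (sel_card sQ) !cardsU1 !inE !negb_or (sel_card sQ).
rewrite aS bS ab pS qS pq leqnn andbT -Qb subUset (sel_mono sQ) andbT.
rewrite setU1CA; apply: subset_trans (sel_mono sQ _ b).
by rewrite Qa sub1set !inE eqxx.
Qed.

(** When a and b claim the same position p, supermodularity for [rank_weight] makes the second
    position weigh at least as much as p, so it comes strictly earlier. *)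
Lemma sel_same u v Q S a b p : selection u v Q ->
  a \notin S -> b \notin S -> a != b -> p \notin Q S ->
  Q (a |: S) = p |: Q S -> Q (b |: S) = p |: Q S ->
  exists q : 'I_n, [/\ q < p, q \notin Q S & Q (a |: (b |: S)) = q |: (p |: Q S)].
Proof.
move=> sQ aS bS ab pS Qa Qb.
have abS : a \notin b |: S by rewrite !inE negb_or ab.
have [q + E] := sel_setU1 sQ abS; rewrite Qb !inE negb_or => /andP[qp qS].
exists q; split=> //; last by rewrite E Qb.
have := sel_supermodular sQ (@rank_weight_nonincreasing n) aS bS ab.
rewrite E Qa Qb !weightU1 // ?inE ?negb_or ?qp //.
rewrite ltn_neqAle (inj_eq val_inj) qp leqNgt -rank_weight_lt -leNgt.
by lia.
Qed.

(** Let i and j claim positions p < q over [Q S]. Inserting a can reverse the preference for j only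
    if a itself claims q, and then the inclusion is monotonicity. If a claims p, [sel_same] replaces
    its claim by one before p, and the preference stays strict. *)
Lemma sel_exchange u v Q S i j a : selection u v Q ->
  uniq [:: i; j; a] -> all [pred e | e \notin S] [:: i; j; a] ->
  (rk Q (j |: S) < rk Q (i |: S))%R ->
  (rk Q (a |: (i |: S)) <= rk Q (a |: (j |: S)))%R ->
  Q (j |: S) \subset Q (a |: (i |: S)).
Proof.
move=> sQ; rewrite /= !inE negb_or => /and3P[/andP[ij ia] ja _] /and4P[iS jS aS _].
have [p pS Qi] := sel_setU1 sQ iS; have [q qS Qj] := sel_setU1 sQ jS.
have [r rS Qa] := sel_setU1 sQ aS.
rewrite Qi Qj !weightU1 // ltrD2r rank_weight_lt => pq.
have pNq : p != q by apply/eqP => e; move: pq; rewrite e ltnn.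
have [rq|rq] := eqVneq r q.
  by move=> _; rewrite -rq -Qa setU1CA (sel_mono sQ).
rewrite (sel_two sQ (b := j) _ _ _ Qa Qj) // 1?eq_sym //.
rewrite !weightU1 // ?inE ?negb_or ?rq //.
have [rp|rp] := eqVneq r p; last first.
  rewrite (sel_two sQ (b := i) _ _ _ Qa Qi) // 1?eq_sym //.
  rewrite !weightU1 // ?inE ?negb_or ?rp //.
  by rewrite lerD2l lerD2r leNgt rank_weight_lt pq.
move: Qa; rewrite rp => Qa.
have [||t [tp tS ->]] := sel_same sQ aS iS _ _ Qa Qi; rewrite 1?eq_sym //.
rewrite !weightU1 // ?inE ?negb_or; last by rewrite tS -(inj_eq val_inj) (ltn_eqF tp).
rewrite addrCA lerD2l lerD2r leNgt rank_weight_lt.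
by rewrite (ltn_trans tp pq).
Qed.

End Selection.

(** * One letter of the word: passing from a selection for v to one for s_i ∘ v *)

Section SelectionStep.
Variable n : nat.
Variables (u v : 'S_n) (Q : {set 'I_n} -> {set 'I_n}) (i j : 'I_n).
Implicit Types (S I L : {set 'I_n}).
Hypotheses (ji : j = i.+1 :> nat) (sQ : selection u v Q).

Local Notation rk Q S := (weight (@rank_weight n) (Q S)).

(* The two candidates differ in one element, so the comparison made by the weight
   [n - q] is the same for every nonincreasing weight. *)
Definition select_swap S :=
  if [&& i \in S, j \notin S & (rk Q (j |: S :\ i) < rk Q S)%R]
  then Q (j |: S :\ i) else Q S.

Let ij : i != j.
Proof. by apply/eqP => e; move: ji; rewrite e; lia. Qed.

Lemma select_swap1 S : i \notin S -> j \notin S ->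
  select_swap (i |: S) =
  if (rk Q (j |: S) < rk Q (i |: S))%R then Q (j |: S) else Q (i |: S).
Proof.
by move=> iS jS; rewrite /select_swap !inE eqxx /= negb_or eq_sym ij jS setU1K.
Qed.

Lemma select_swapN S : i \notin S -> select_swap S = Q S.
Proof. by move=> iS; rewrite /select_swap (negPf iS). Qed.

Lemma select_swapT S : j \in S -> select_swap S = Q S.
Proof. by move=> jS; rewrite /select_swap jS andbF. Qed.

Lemma swap_cases S :
  [\/ i \notin S, j \in S | exists S0, [/\ i \notin S0, j \notin S0 & S = i |: S0]].
Proof.
have [iS|iS] := boolP (i \in S); last by constructor 1.
have [jS|jS] := boolP (j \in S); first by constructor 2.
constructor 3; exists (S :\ i); rewrite setD1K //; split=> //.
  by rewrite !inE eqxx.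
by rewrite !inE negb_and jS orbT.
Qed.

Lemma weight_select_swap lam S : nonincreasing lam ->
  weight lam (select_swap S) = min_act i j (fun S => weight lam (Q S)) S.
Proof.
move=> lamN; have [iS|jS|[S0 [iS jS ->]]] := swap_cases S.
- by rewrite select_swapN // min_actN.
- by rewrite select_swapT // min_actT.
rewrite select_swap1 // min_act1 //; case: ltP => le_rk.
  by rewrite min_r // (sel_weight_le sQ) // ltW.
by rewrite min_l // (sel_weight_le sQ).
Qed.

Lemma card_select_swap S : #|select_swap S| = #|S|.
Proof.
have [iS|jS|[S0 [iS jS ->]]] := swap_cases S.
- by rewrite select_swapN // (sel_card sQ).
- by rewrite select_swapT // (sel_card sQ).
by rewrite select_swap1 //; case: ifP => _; rewrite (sel_card sQ) ?cardsU1 ?iS ?jS.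
Qed.

Lemma select_swap_mono S a : select_swap S \subset select_swap (a |: S).
Proof.
have [aS|aS] := boolP (a \in S); first by rewrite (setUidPr _) ?sub1set.
have mono := sel_mono sQ.
have [iS|jS|[S0 [iS jS ES]]] := swap_cases S.
- rewrite select_swapN //; have [ai|ai] := eqVneq a i; last first.
    by rewrite select_swapN ?mono // !inE negb_or eq_sym ai.
  have [jS|jS] := boolP (j \in S).
    by rewrite select_swapT ?mono // !inE jS orbT.
  by rewrite ai select_swap1 //; case: ifP.
- by rewrite !select_swapT ?mono // !inE jS orbT.
move: aS; rewrite ES !inE negb_or => /andP[ai aS].
have [aj|aj] := eqVneq a j.
  rewrite aj (@select_swapT (j |: _)) ?inE ?eqxx // select_swap1 //.
  by case: ifP => _; rewrite ?mono // setUCA mono.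
have [iaS jaS] : i \notin a |: S0 /\ j \notin a |: S0.
  by rewrite !inE !negb_or eq_sym ai iS eq_sym aj.
rewrite setUCA !select_swap1 //.
(* Where the two comparisons agree, monotonicity of [Q] suffices. Where they disagree,
   [sel_exchange] applies, except at a tie, where the two candidates coincide. *)
case: ltP => ltij; case: ltP => ltija.
- by rewrite setUCA mono.
- rewrite setUCA; apply: (sel_exchange sQ) => //=; last by rewrite !(setUCA [set a]).
    by rewrite !inE negb_or ij ![_ == a]eq_sym ai aj.
  by rewrite iS jS aS.
- move: ltij; rewrite le_eqVlt => /orP[/eqP e|ltij].
    by rewrite (sel_weight_eq sQ iS jS e) setUCA mono.
  rewrite setUCA; apply: (sel_exchange sQ) => //=; last by rewrite !(setUCA [set a]) ltW.
    by rewrite !inE negb_or (eq_sym j) ij ![_ == a]eq_sym ai aj.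
  by rewrite iS jS aS.
- by rewrite setUCA mono.
Qed.

Lemma select_swap_upper m : select_swap [set x : 'I_n | m <= x] = [set p | m <= u p].
Proof.
rewrite -(sel_upper sQ); have [iS|iS] := boolP (i \in [set x : 'I_n | m <= x]).
  by rewrite select_swapT //; move: iS; rewrite !inE ji; apply: leqW.
by rewrite select_swapN.
Qed.

(** The condition for left multiplication by s_i to lengthen v. *)
Hypothesis inc : ((v^-1)%g i < (v^-1)%g j).

Lemma select_swap_lower m :
  select_swap [set x : 'I_n | x < m] = [set p | perm_comp (tperm i j) v p < m].
Proof.
(* Among the initial segments only {x | x < j} contains i without j. *)
have [mj|mj] := eqVneq m j; last first.
  have -> : [set p | perm_comp (tperm i j) v p < m] = [set p | v p < m].
    apply/setP => p; rewrite !inE permM; case: tpermP => // ->; move: ji mj; lia.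
  rewrite -(sel_lower sQ); have [iS|iS] := boolP (i \in [set x : 'I_n | x < m]).
    by rewrite select_swapT //; move: iS; rewrite !inE ji; move: ji mj; lia.
  by rewrite select_swapN.
rewrite {}mj; pose S0 := [set x : 'I_n | x < i].
have iS : i \notin S0 by rewrite inE ltnn.
have jS : j \notin S0 by rewrite inE ji; lia.
have -> : [set x : 'I_n | x < j] = i |: S0.
  by apply/setP => x; rewrite !inE ji (ltnS x i) (leq_eqVlt x i).
have jiS : j |: (i |: S0) = [set x : 'I_n | x < j.+1].
  apply/setP => x; rewrite !inE -(inj_eq val_inj x j) /=.
  by rewrite (ltnS x j) (leq_eqVlt x j) ji (ltnS x i) (leq_eqVlt x i).
have vV x : v ((v^-1)%g x) = x by rewrite permKV.
have ivS : (v^-1)%g i \notin Q S0 by rewrite (sel_lower sQ) inE vV ltnn.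
have jvS : (v^-1)%g j \notin Q S0 by rewrite (sel_lower sQ) inE vV ji; lia.
have QS0 : Q S0 = [set p | v p < i] by rewrite (sel_lower sQ).
have vE p x : (v p == x) = (p == (v^-1)%g x) by rewrite -(canF_eq (permK v)).
have Qi : Q (i |: S0) = (v^-1)%g i |: Q S0.
  have -> : i |: S0 = [set x : 'I_n | x < i.+1].
    by apply/setP => x; rewrite !inE (ltnS x i) (leq_eqVlt x i).
  rewrite QS0 (sel_lower sQ); apply/setP => p.
  by rewrite !inE (ltnS _ i) (leq_eqVlt _ i) -vE.
have Qij : Q (j |: (i |: S0)) = (v^-1)%g j |: ((v^-1)%g i |: Q S0).
  rewrite jiS QS0 (sel_lower sQ); apply/setP => p.
  by rewrite !inE (ltnS _ j) (leq_eqVlt _ j) ji (ltnS _ i) (leq_eqVlt _ i) -!vE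
    -(inj_eq val_inj (v p) j) /= ji.
have [q qS Qj] := sel_setU1 sQ jS.
(* If j also claimed the position of i, [sel_same] would put v^-1(j) before v^-1(i), against
   [inc]. *)
have qE : q = (v^-1)%g j.
  have : q \in Q (j |: (i |: S0)).
    by rewrite setUCA; apply: (subsetP (sel_mono sQ _ i)); rewrite Qj !inE eqxx.
  rewrite Qij !inE (negPf qS) orbF => /orP[/eqP //|/eqP qi].
  have [] := sel_same sQ jS iS _ ivS _ Qi; rewrite 1?eq_sym // ?Qj ?qi //.
  move=> t [lt_t tS]; rewrite Qij => /setP/(_ ((v^-1)%g j)).
  rewrite !inE eqxx /= => /esym; rewrite (negPf jvS) orbF -!(inj_eq val_inj).
  by rewrite (gtn_eqF inc) orbF => /eqP/val_inj e; move: (ltn_trans lt_t inc); rewrite e ltnn.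
rewrite select_swap1 // Qi Qj qE !weightU1 // ltrD2r rank_weight_lt inc QS0.
apply/setP => p; rewrite !inE permM -vE; case: tpermP => [->|->|/eqP pi /eqP pj].
- by rewrite (negPf ij) !ltnn.
- by rewrite eqxx ji leqnn.
have {}pi : v p <> i :> nat by move=> /val_inj/eqP; rewrite (negPf pi).
by rewrite (negPf pj) ji; clear -pi; lia.
Qed.

Lemma prefix_set_swap d :
  prefix_set (perm_comp (tperm i j) v) d = tperm i j @: prefix_set v d.
Proof. by rewrite /prefix_set -imset_comp; apply: eq_imset => p; rewrite /= permM. Qed.

Lemma count_select_swap S d :
  count_below (select_swap S) d <= count_below (Q S) d /\
  (i \in S -> j \notin S ->
   count_below (select_swap S) d <= count_below (Q (j |: S :\ i)) d).
Proof.
have := weight_select_swap S (@threshold_nonincreasing n d).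
rewrite /min_act !weight_threshold.
case: ifP => [_|ijS] E; split; last by move=> iS jS; rewrite iS jS in ijS.
- by clear -E; lia.
- by move=> _ _; clear -E; lia.
- by clear -E; lia.
Qed.

(** If I lies below the old prefix set V, the old bound applies directly. Otherwise I is lowered
    from j to i to come below V, and L either remains the join or is lowered together with I. *)
Lemma select_swap_bound d I L S :
  (forall m, height I m <= height (prefix_set (perm_comp (tperm i j) v) d) m) ->
  (forall m, height L m = maxn (height I m) (height (prefix_set u d) m)) ->
  count_below (select_swap S) d <= #|L :&: S|.
Proof.
rewrite prefix_set_swap; set V := prefix_set v d; set U := prefix_set u d => leI hL.
have [le1 le2] := count_select_swap S d.
have [/forallP leV|] := boolP [forall m : 'I_n.+1, height I m <= height V m].
  apply: leq_trans le1 _; apply: (sel_bound sQ _ _ hL) => m.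
  have [mn|nm] := leqP m n; first exact: (leV (Ordinal (mn : m < n.+1))).
  rewrite [height I m](_ : _ = 0) // /height.
  rewrite (_ : [set x : 'I_n | m <= x] = set0) ?setI0 ?cards0 //.
  by apply/setP => x; rewrite !inE leqNgt (ltn_trans (ltn_ord x) nm).
rewrite negb_forall => /existsP[m0]; rewrite -ltnNge => lt0.
have [jI iI leI'] := height_le_swap ji leI lt0.
have hI m : height I m = height (i |: I :\ j) m + (m == j).
  rewrite -(height_swap _ ji) ?swapK 1?eq_sym //; rewrite !inE ?eqxx //.
  by rewrite negb_or eq_sym ij.

(* If U is at least as high as I at the threshold j, lowering I leaves the join with U unchanged. *)
have [leUI|ltUI] := leqP (height I j) (height U j).
  apply: leq_trans le1 _; apply: (sel_bound sQ _ leI') => m.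
  rewrite hL hI -/U; case: eqP => [->|_]; rewrite ?addn0 //.
  by move: leUI; rewrite hI eqxx; lia.
have := heightS j L; have := heightS i L; have := heightS j I; have := heightS i I.
have := heightS j U; have := heightS i U; rewrite -ji jI (negPf iI) !hL => Ui Uj Ii Ij Li Lj.
have jL : j \in L.
  by move: Lj Uj Ij ltUI; case: (j \in L) => //; lia.
have iL : i \notin L.
  by apply/negP => iL; move: Li Ui Ii ltUI; rewrite iL; lia.
(* Here I alone determines the height of L at j, so L contains j but not i, and lowering it gives
   the join of the lowered I with U. *)
pose K := i |: L :\ j.
have hK m : height L m = height K m + (m == j).
  rewrite -(height_swap _ ji) ?swapK 1?eq_sym //; rewrite !inE ?eqxx //.
  by rewrite negb_or eq_sym ij.
have bK T : count_below (Q T) d <= #|K :&: T|.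
  apply: (sel_bound sQ _ leI') => m; have := hK m; rewrite hL hI -/U.
  by case: eqP => [->|_]; rewrite ?addn0 //; move: ltUI; rewrite hI eqxx; lia.
have := card_swapI S jL iL; rewrite -/K => cK.
have [iS|iS] := boolP (i \in S); last first.
  by apply: leq_trans le1 (leq_trans (bK S) _); move: cK; rewrite (negPf iS); lia.
have [jS|jS] := boolP (j \in S).
  by apply: leq_trans le1 (leq_trans (bK S) _); move: cK; rewrite iS jS; lia.
(* Now K meets S once more than L does, so the bound for [Q S] is off by one. The other candidate is
   used: K meets the swapped S exactly as often as L meets S. *)
apply: leq_trans (le2 iS jS) (leq_trans (bK _) _).
have := card_swapI K iS jS; rewrite ![_ :&: K]setIC iS (negPf jS) in cK *.
have -> : i \in K by rewrite !inE eqxx.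
have -> : (j \in K) = false by rewrite !inE eqxx eq_sym (negPf ij).
by move: cK; rewrite !add0n !add1n => -> [->].
Qed.

Lemma selection_swap : selection u (perm_comp (tperm i j) v) select_swap.
Proof.
split.
- exact: card_select_swap.
- exact: select_swap_mono.
- move=> lam lamN; have := mv_min_act ji (sel_mv sQ lamN).
  by rewrite (_ : min_act _ _ _ = fun S => weight lam (select_swap S)) //;
     apply/boolp.funext => S; rewrite weight_select_swap.
- move=> lam lamN.
  have := supermodular_min_act ji (sel_mv sQ lamN) (sel_supermodular sQ lamN).
  by rewrite (_ : min_act _ _ _ = fun S => weight lam (select_swap S)) //;
     apply/boolp.funext => S; rewrite weight_select_swap.
- exact: select_swap_upper.
- exact: select_swap_lower.
- exact: select_swap_bound.
Qed.

End SelectionStep.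

(** * Coxeter length as the number of inversions *)

Section CoxeterLength.
Variable n : nat.
Implicit Types (u v w s t : 'S_n) (i j x y : 'I_n).

Definition inversions w : nat :=
  \sum_(p : 'I_n * 'I_n) ((p.1 < p.2) && (w p.2 < w p.1)).

Lemma tperm_lt i j x y : j = i.+1 :> nat ->
  (x, y) != (i, j) -> (x, y) != (j, i) -> (tperm i j x < tperm i j y) = (x < y).
Proof.
move=> ji; rewrite !xpair_eqE.
have ij : i != j by apply/eqP => e; move: ji; rewrite e; lia.
have nE (a b : 'I_n) : a <> b -> a <> b :> nat by move=> ab /val_inj.
case: tpermP => [->|->|/nE xi /nE xj]; case: tpermP => [->|->|/nE yi /nE yj];
  rewrite ?eqxx ?(eq_sym j i) ?(negPf ij) //= ?ltnn //; lia.
Qed.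

Lemma inversions_swapr w i j : j = i.+1 :> nat -> w i < w j ->
  inversions (perm_comp w (tperm i j)) = (inversions w).+1.
Proof.
move=> ji wij; set t := tperm i j.
have ij : i != j by apply/eqP => e; move: ji; rewrite e; lia.
have -> : inversions (perm_comp w t) =
    \sum_(p : 'I_n * 'I_n) ((t p.1 < t p.2) && (w p.2 < w p.1)).
  rewrite /inversions (reindex_inj (h := fun p : 'I_n * 'I_n => (t p.1, t p.2))); last first.
    by move=> [a b] [c d] [] /perm_inj -> /perm_inj ->.
  by apply: eq_bigr => -[a b] _; rewrite /= !permM /t !tpermK.
rewrite /inversions (bigD1 (j, i)) //= [in RHS](bigD1 (j, i)) //=.
rewrite tpermR tpermL wij ji ltnSn ltnNge leqnSn /= add0n add1n; congr _.+1.
apply: eq_bigr => -[a b] ab /=; have [abE|abN] := eqVneq (a, b) (i, j).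
  by case: abE => -> ->; rewrite [w j < _]ltnNge (ltnW wij) !andbF.
by rewrite tperm_lt.
Qed.

Lemma inversionsV w : inversions (w^-1)%g = inversions w.
Proof.
rewrite /inversions (reindex_inj (h := fun p : 'I_n * 'I_n => (w p.2, w p.1))); last first.
  by move=> [a b] [c d] [] /perm_inj -> /perm_inj ->.
by apply: eq_bigr => -[a b] _; rewrite /= !permK andbC.
Qed.

Lemma inversions_swapl w i j : j = i.+1 :> nat -> (w^-1)%g i < (w^-1)%g j ->
  inversions (perm_comp (tperm i j) w) = (inversions w).+1.
Proof.
move=> ji wij; rewrite -inversionsV -(inversionsV w) -(inversions_swapr ji wij).
by rewrite /perm_comp invMg tpermV.
Qed.

Lemma perm_compK i j w : perm_comp (tperm i j) (perm_comp (tperm i j) w) = w.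
Proof. by rewrite /perm_comp -mulgA tperm2 mulg1. Qed.

Lemma inversions_swapl_desc w i j : j = i.+1 :> nat -> (w^-1)%g j < (w^-1)%g i ->
  inversions w = (inversions (perm_comp (tperm i j) w)).+1.
Proof.
move=> ji wji; rewrite -(inversions_swapl (i := i) (j := j)) ?perm_compK //.
by rewrite /perm_comp invMg tpermV !permM tpermL tpermR.
Qed.

Lemma inversions_swapr_desc w i j : j = i.+1 :> nat -> w j < w i ->
  inversions w = (inversions (perm_comp w (tperm i j))).+1.
Proof.
move=> ji wji; rewrite -(inversions_swapr (i := i) (j := j)) //.
  by rewrite /perm_comp mulgA tperm2 mul1g.
by rewrite /perm_comp !permM tpermL tpermR.
Qed.

Lemma perm_neq_lt w i j : i != j -> (w i < w j) || (w j < w i).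
Proof. by move=> ij; rewrite -neq_ltn (inj_eq val_inj) (inj_eq perm_inj). Qed.

Lemma succ_neq i j : j = i.+1 :> nat -> i != j.
Proof. by move=> ji; apply/eqP => e; move: ji; rewrite e; lia. Qed.

Lemma inversions_expression a w : expression a w -> inversions w <= size a.
Proof.
case=> + <-; elim: a => [|s a IHa] sa /=.
  rewrite leqn0 sum_nat_eq0; apply/forallP => -[x y] /=; rewrite !perm1.
  by rewrite eqb0; apply/negP => /andP[]; lia.
have [|i [j [ji ->]]] := sa s; first by rewrite mem_head.
have {}IHa : inversions (word_perm a) <= size a.
  by apply: IHa => x xa; apply: sa; rewrite inE xa orbT.
have /orP[lt|lt] := perm_neq_lt (word_perm a)^-1 (succ_neq ji).
  by rewrite inversions_swapl.
by apply: leqW; apply: leq_trans IHa; rewrite [leqRHS](inversions_swapl_desc ji lt).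
Qed.

(** An increasing permutation is pointwise at least the identity, and so is its inverse. *)
Lemma perm_increasing w : (forall i j, j = i.+1 :> nat -> w i < w j) -> w = 1%g.
Proof.
move=> inc.
have mono x y : x < y -> w x < w y.
  move: y; suff H k (y : 'I_n) : y = x + k.+1 :> nat -> w x < w y.
    by move=> y xy; apply: (H (y - x).-1); lia.
  elim: k y => [|k IHk] y yk; first by apply: inc; lia.
  have lt : x + k.+1 < n by have := ltn_ord y; lia.
  by apply: ltn_trans (IHk (Ordinal lt) erefl) (inc _ _ _) => /=; lia.
have ge (p : 'S_n) : (forall x y, x < y -> p x < p y) -> forall x, x <= p x.
  move=> pm [m]; elim: m => [|m IHm] ltm //=.
  have ltm' : m < n by apply: ltn_trans ltm.
  by apply: leq_ltn_trans (IHm ltm') (pm _ _ _) => /=.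
have monoV x y : x < y -> (w^-1)%g x < (w^-1)%g y.
  move=> xy; have [//|yx|/val_inj/perm_inj e] := ltngtP ((w^-1)%g x) ((w^-1)%g y).
    by have := mono _ _ yx; rewrite !permKV; lia.
  by move: xy; rewrite e ltnn.
apply/permP => x; rewrite perm1; apply/val_inj/eqP; rewrite eqn_leq (ge w mono) andbT.
by have := ge _ monoV (w x); rewrite permK.
Qed.

Lemma left_descent w : w <> 1%g ->
  exists i j, j = i.+1 :> nat /\ (w^-1)%g j < (w^-1)%g i.
Proof.
move=> w1; have [/existsP[i /existsP[j /andP[/eqP ji lt]]]|no] :=
    boolP [exists i : 'I_n, exists j : 'I_n,
      (j == i.+1 :> nat) && ((w^-1)%g j < (w^-1)%g i)].
  by exists i, j.
case: w1; apply: invg_inj; rewrite invg1; apply: perm_increasing => i j ji.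
have /orP[//|lt] := perm_neq_lt (w^-1)%g (succ_neq ji).
by case/negP: no; apply/existsP; exists i; apply/existsP; exists j; rewrite ji eqxx.
Qed.

(** Stripping a left descent removes exactly one inversion, so the inversion number is attained as a
    word length. *)
Lemma expression_exists w : exists2 a, expression a w & size a = inversions w.
Proof.
have [k] := ubnP (inversions w); elim: k => // k IHk in w *; rewrite ltnS => lek.
have [->|/eqP w1] := eqVneq w 1%g.
  exists [::]; first by split.
  apply/esym/eqP; rewrite -leqn0; apply: (@inversions_expression [::]); by split.
have [i [j [ji lt]]] := left_descent w1.
have E := inversions_swapl_desc ji lt.
have [|a [sa wa] za] := IHk (perm_comp (tperm i j) w); first by rewrite -E.
exists (tperm i j :: a); last by rewrite /= za E.
split=> [s|/=]; last by rewrite -/(word_perm a) wa perm_compK.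
by rewrite inE => /predU1P[->|/sa //]; exists i, j.
Qed.

Lemma reduced_expression_size a w : reduced_expression a w -> size a = inversions w.
Proof.
move=> [ea min_a]; have [b eb sb] := expression_exists w.
by apply/eqP; rewrite eqn_leq inversions_expression // -sb min_a.
Qed.

Lemma has_lengthE w k : has_length w k <-> k = inversions w.
Proof.
split=> [[a [/reduced_expression_size <- //]]|->].
have [a ea sa] := expression_exists w; exists a; split=> //; split=> // b eb.
by rewrite sa inversions_expression.
Qed.

(** Induction on j - i, writing the transposition as a conjugate of (i+1, j) by the adjacent (i,
    i+1). The inner factor raises the count by induction; the outer two change it by one each and
    never both lower it. *)
Lemma inversions_tperm w i j : i < j -> w i < w j ->
  inversions w < inversions (perm_comp w (tperm i j)).
Proof.
move: i; have [k] := ubnP (j : nat); move: k.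
suff H k : forall i w, j = i + k.+1 :> nat -> w i < w j ->
    inversions w < inversions (perm_comp w (tperm i j)).
  by move=> _ _ i ij wij; apply: (H (j - i).-1) => //; lia.
elim: k => [|k IHk] i {}w jk wij.
  by rewrite inversions_swapr //; lia.
have lth : i.+1 < n by have := ltn_ord j; lia.
pose h := Ordinal lth; have hi : h = i.+1 :> nat by [].
have ih := succ_neq hi.
have hj : h != j by apply/eqP => e; move: jk; rewrite -e /=; lia.
have ij : i != j by apply/eqP => e; move: jk; rewrite -e /=; lia.
pose w1 := perm_comp w (tperm i h); pose w2 := perm_comp w1 (tperm h j).
have E : perm_comp w (tperm i j) = perm_comp w2 (tperm i h).
  rewrite /w2 /w1 /perm_comp !mulgA; congr (_ * _)%g.
  have := tpermJ h j (tperm i h); rewrite tpermR tpermD // => <-.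
  by rewrite conjgE tpermV !mulgA.
have w1i : w1 i = w h by rewrite permM tpermL.
have w1h : w1 h = w i by rewrite permM tpermR.
have w1j : w1 j = w j by rewrite permM tpermD.
have w2i : w2 i = w h by rewrite permM tpermD // 1?eq_sym.
have w2h : w2 h = w j by rewrite permM tpermL.
have lt12 : inversions w1 < inversions w2.
  by apply: IHk; rewrite ?w1h ?w1j //= jk; lia.
rewrite E; have /orP[wih|whi] := perm_neq_lt w ih.
  have e1 : inversions w1 = (inversions w).+1 by apply: inversions_swapr.
  have /orP[lt|lt] := perm_neq_lt w2 ih.
    by rewrite (inversions_swapr hi lt); lia.
  by have := inversions_swapr_desc hi lt; lia.
rewrite (inversions_swapr hi) ?w2i ?w2h; last exact: ltn_trans wij.
by have := inversions_swapr_desc hi whi; rewrite -/w1; lia.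
Qed.

End CoxeterLength.

(** * The tableau criterion for the strong Bruhat order *)

Section Tableau.
Variable n : nat.
Implicit Types (u v w : 'S_n) (a b p : 'I_n) (d m : nat).

Definition tableau_le u v := forall d m,
  height (prefix_set u d) m <= height (prefix_set v d) m.

Lemma height_prefix w d m :
  height (prefix_set w d) m = #|[set p : 'I_n | (p < d) && (m <= w p)]|.
Proof.
rewrite -(card_imset _ (@perm_inj _ w)); apply: eq_card => x.
rewrite !inE -[x in RHS](permKV w) (mem_imset _ _ perm_inj) inE permKV.
by rewrite -{1}(permKV w x) (mem_imset _ _ perm_inj) inE.
Qed.

Lemma card_preim_tperm a b (A : {set 'I_n}) : #|tperm a b @^-1: A| = #|A|.
Proof. by rewrite on_card_preimset //; exists (tperm a b) => p _; rewrite tpermK. Qed.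

Lemma height_prefix_out w a b d m : a < b -> (d <= a) || (b < d) ->
  height (prefix_set (perm_comp w (tperm a b)) d) m = height (prefix_set w d) m.
Proof.
move=> ab out; rewrite !height_prefix -[RHS](card_preim_tperm a b).
apply: eq_card => p; rewrite !inE permM; congr (_ && _).
by case: tpermP => // ->; move: ab out; lia.
Qed.

Lemma height_prefix_in w a b d m : a < d -> d <= b ->
  height (prefix_set (perm_comp w (tperm a b)) d) m + (m <= w a) =
  height (prefix_set w d) m + (m <= w b).
Proof.
move=> ad db; rewrite !height_prefix.
rewrite (cardsD1 a) [in RHS](cardsD1 a) !inE ad permM tpermL /=.
rewrite addnAC [RHS]addnAC [RHS]addnC addnC [(m <= w b) + _]addnC; congr (_ + _).
apply: eq_card => p; rewrite !inE permM; have [//|pa] := eqVneq p a.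
have [pd /=|//] := boolP (p < d).
rewrite tpermD 1?eq_sym //; apply/eqP => e; move: pd; rewrite e; lia.
Qed.

Lemma bruhat_step_tableau u v : bruhat_step u v -> tableau_le u v.
Proof.
move=> [t [k [l [[a [b [ab ->]]] -> /has_lengthE -> /has_lengthE -> lt]]]].
wlog {ab} ab : a b lt / a < b.
  move=> H; have [ltab|ltba|/val_inj e] := ltngtP a b; first exact: H.
    by rewrite tpermC; apply: H => //; rewrite tpermC.
  by rewrite e eqxx in ab.
(* Otherwise undoing the transposition would itself increase the length, by [inversions_tperm]. *)
have uab : u a < u b.
  have /orP[//|uba] : (u a < u b) || (u b < u a).
    by apply: perm_neq_lt; rewrite -(inj_eq val_inj) (ltn_eqF ab).
  have := @inversions_tperm _ (perm_comp u (tperm a b)) a b ab.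
  rewrite /perm_comp !permM tpermL tpermR => /(_ uba).
  by rewrite mulgA tperm2 mul1g ltnNge (ltnW lt).
move=> d m; have [out|] := boolP ((d <= a) || (b < d)).
  by rewrite height_prefix_out.
rewrite negb_or -ltnNge -leqNgt => /andP[ad db].
by have := height_prefix_in u m ad db; move: uab; lia.
Qed.

Lemma bruhat_le_tableau u v : bruhat_le u v -> tableau_le u v.
Proof.
elim=> [x y|x|x y z _ xy _ yz] //; first exact: bruhat_step_tableau.
by move=> d m; apply: leq_trans (xy d m) (yz d m).
Qed.

Lemma height_prefix_split w a d m : a < d ->
  height (prefix_set w d) m = height (prefix_set w a) m + (m <= w a) +
    #|[set p : 'I_n | [&& a < p, p < d & m <= w p]]|.
Proof.
move=> ad; rewrite !height_prefix.
have cardE (P : pred 'I_n) : #|[set p | P p]| = \sum_p P p.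
  by rewrite -sum1dep_card big_mkcond; apply: eq_bigr => p _; case: (P p).
have -> : (m <= w a : nat) = \sum_(p : 'I_n) ((p == a) && (m <= w p)).
  by rewrite (bigD1 a) //= eqxx big1 ?addn0 // => p /negPf ->.
rewrite !cardE -!big_split; apply: eq_bigr => p _ /=.
rewrite -(inj_eq val_inj) /=; case: (m <= w p); rewrite ?andbF // ?andbT.
by move: ad; case: (ltngtP p a); lia.
Qed.

(* At the first position a where u and v differ, exchange u a with the next value
   to its right lying in (u a, v a]. *)
Lemma tableau_step u v : tableau_le u v -> u <> v ->
  exists w, bruhat_step u w /\ tableau_le w v.
Proof.
move=> uv neq_uv.
have [a0 a0P] : exists a, u a != v a.
  apply/existsP; apply: contra_notT neq_uv; rewrite negb_exists => /forallP uvE.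
  by apply/permP => p; apply/eqP; rewrite -[_ == _]negbK uvE.
have [a aP a_min] : exists2 a, u a != v a & forall p, p < a -> u p = v p.
  case: (@arg_minnP _ a0 (fun a => u a != v a) (@nat_of_ord n) a0P) => a aP amin.
  exists a => // p pa; apply/eqP; apply: contraTT pa => up.
  by rewrite -leqNgt amin.
have prefE m : height (prefix_set u a) m = height (prefix_set v a) m.
  rewrite !height_prefix; apply: eq_card => p; rewrite !inE.
  by case: ltnP => // pa; rewrite (a_min _ pa).
have emptyE w' m : #|[set p : 'I_n | [&& a < p, p < a.+1 & m <= w' p]]| = 0.
  by apply/eqP; rewrite cards_eq0; apply/eqP/setP => p; rewrite !inE ltnS; case: ltngtP.
have ltuv : u a < v a.
  have := uv a.+1 (u a); rewrite !(@height_prefix_split _ a a.+1) //.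
  rewrite prefE !emptyE leqnn !addn0 leq_add2l lt0b => le_uv.
  by rewrite ltn_neqAle le_uv andbT.
(* The position where u takes the value v a shows that there is a candidate for the exchange. *)
pose c := (u^-1)%g (v a); have uc : u c = v a by rewrite permKV.
have ac : a < c.
  have [//|ca|/val_inj e] := ltngtP a c.
    by have := a_min _ ca; rewrite uc => /perm_inj e; move: ca; rewrite -e ltnn.
  by move: aP; rewrite -uc e eqxx.
have [b /and3P[ab ub bv] b_min] : exists2 b : 'I_n, [&& a < b, u a < u b & u b <= v a] &
    forall p : 'I_n, a < p -> p < b -> ~~ ((u a < u p) && (u p <= v a)).
  have cP : [&& a < c, u a < u c & u c <= v a] by rewrite ac uc ltuv leqnn.
  case: (@arg_minnP _ c (fun b : 'I_n => [&& a < b, u a < u b & u b <= v a])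
    (@nat_of_ord n) cP) => b bP bmin.
  exists b => // p ap; apply: contraTN => up; rewrite -leqNgt bmin //.
  by rewrite ap.
exists (perm_comp u (tperm a b)); split.
  exists (tperm a b), (inversions u), (inversions (perm_comp u (tperm a b))).
  split=> //; try exact/has_lengthE; last exact: inversions_tperm.
  by exists a, b; split=> //; apply/eqP => e; move: ab; rewrite e ltnn.
move=> d m; have [out|] := boolP ((d <= a) || (b < d)).
  by rewrite height_prefix_out.
rewrite negb_or -ltnNge -leqNgt => /andP[ad db].
have := height_prefix_in u m ad db.
have [|mid] := boolP ((u a < m) && (m <= u b)); last first.
  move: mid (uv d m) ub; case: (leqP m (u a)) => h1; case: (leqP m (u b)) => h2 //= _.
  - by move=> h3 _ /addIn ->.
  - by move=> _ h3; have := leq_ltn_trans h1 h3; rewrite ltnNge (ltnW h2).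
  - by move=> h3 _; rewrite !addn0 => ->.
move=> /andP[uam mub]; rewrite leqNgt uam mub addn0 addn1 => ->.
(* By minimality of b, u takes no value in (u a, v a] strictly between a and d, so counting from m
   or from v a + 1 gives the same number. At v a + 1 the hypothesis compares these counts, and v a
   itself supplies the extra unit at m. *)
have := uv d (v a).+1; rewrite !(@height_prefix_split _ a d) // !prefE.
have -> : (v a < u a) = false by apply/negbTE; rewrite -leqNgt ltnW.
have -> : (m <= u a) = false by apply/negbTE; rewrite -ltnNge.
have -> : m <= v a by apply: leq_trans bv.
rewrite ltnn leq_add2l -!addnA ltn_add2l [false + _]add0n [true + _]add1n ltnS => le_mid.
set A := #|_|; set B := #|_| in le_mid; have -> : A = B.
  apply: eq_card => p; rewrite !inE; case: (ltnP a p) => //= ap.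
  case: (ltnP p d) => //= pd; have := b_min p ap (leq_trans pd db).
  rewrite negb_and -leqNgt -ltnNge; case: (ltnP (v a) (u p)) => [lt _|_].
    by rewrite (leq_trans _ (ltnW lt)) // (leq_trans mub bv).
  by rewrite orbF => le; apply/negbTE; rewrite -ltnNge (leq_ltn_trans le).
apply: leq_trans le_mid _; apply: subset_leq_card; apply/subsetP => p.
rewrite !inE => /and3P[-> -> lt] /=.
by rewrite (leq_trans _ (ltnW lt)) // (leq_trans mub bv).
Qed.

Lemma inversions_le w : inversions w <= #|{: 'I_n * 'I_n}|.
Proof.
rewrite -sum1_card; apply: leq_sum => p _; exact: leq_b1.
Qed.

Lemma bruhat_leE u v : bruhat_le u v <-> tableau_le u v.
Proof.
split; first exact: bruhat_le_tableau.
have [k] := ubnP (#|{: 'I_n * 'I_n}| - inversions u).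
elim: k => // k IHk in u *; rewrite ltnS => lek uv.
have [->|/eqP neq_uv] := eqVneq u v; first exact: rt_refl.
have [w [uw wv]] := tableau_step uv neq_uv.
apply: rt_trans (IHk w _ wv); first exact: rt_step.
case: uw => [t [k' [l [_ _ /has_lengthE kE /has_lengthE lE]]]]; rewrite kE lE => lt.
by have := inversions_le w; lia.
Qed.

End Tableau.

(** * Selections along reduced words, and greedy permutations in the interval *)

Section Greedy.
Variable n : nat.
Implicit Types (u v w s : 'S_n) (S T X Y : {set 'I_n}) (Q : {set 'I_n} -> {set 'I_n}).

Lemma left_weak_selection u v : left_weak_le u v -> exists Q, selection u v Q.
Proof.
move=> [a [b [[[sa <-] _] redv]]].
have := reduced_expression_size redv; case: redv => -[sab <-] _.
elim: b sab => [|s b IHb] sab /= sz.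
  by exists (fun S => word_perm a @^-1: S); apply: selection_refl.
have sab' x : x \in b ++ a -> simple_transposition x.
  by move=> xab; apply: sab; rewrite /= inE xab orbT.
have le_size := inversions_expression (conj sab' erefl).
have [|i [j [ji sE]]] := sab s; first by rewrite mem_head.
move: sz; rewrite sE -/(word_perm (b ++ a)) => sz.
(* A descent would give the word without its first letter more inversions than letters. *)
have /orP[inc|dec] := perm_neq_lt (word_perm (b ++ a))^-1 (succ_neq ji).
  rewrite (inversions_swapl ji inc) in sz; case: sz => sz.
  have [Q sQ] := IHb sab' sz.
  by exists (select_swap Q i j); apply: selection_swap.
by have := inversions_swapl_desc ji dec; rewrite -sz; lia.
Qed.

(** Deleting elements of Y outside X one at a time turns local supermodularity into growth of
    marginal increments along inclusions. *)
Lemma supermodular_incr (f : {set 'I_n} -> int) X Y a : supermodular f ->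
  X \subset Y -> a \notin Y -> (f (a |: X) + f Y <= f X + f (a |: Y))%R.
Proof.
move=> SM; have [k] := ubnP #|Y :\: X|; elim: k => // k IHk in Y *.
rewrite ltnS => lek XY aY.
have [YX|] := boolP (Y \subset X).
  have -> : X = Y by apply/eqP; rewrite eqEsubset XY YX.
  by rewrite addrC.
move=> /subsetPn[b bY bX].
have XYb : X \subset Y :\ b by rewrite subsetD1 XY bX.
have aYb : a \notin Y :\ b by rewrite !inE negb_and aY orbT.
have ab : a != b by apply: contraNneq aY => ->.
have := IHk (Y :\ b) _ XYb aYb.
have -> : #|(Y :\ b) :\: X| < k.
  apply: leq_trans lek; apply: proper_card; apply/properP; split.
    by apply: setSD; apply: subD1set.
  by exists b; rewrite !inE ?bX ?bY // eqxx.
move=> /(_ isT).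
have bYb : b \notin Y :\ b by rewrite !inE eqxx.
have := SM (Y :\ b) a b aYb bYb ab; rewrite (setD1K bY).
move: (f (a |: X)) (f Y) (f X) (f (a |: Y)) (f (Y :\ b)) (f (a |: Y :\ b)).
by move=> ? ? ? ? ? ?; lia.
Qed.

Lemma prefix_setS s (k : 'I_n) : prefix_set s k.+1 = s k |: prefix_set s k.
Proof.
rewrite /prefix_set -imsetU1.
rewrite (_ : [set p : 'I_n | p < k.+1] = k |: [set p : 'I_n | p < k]) //.
by apply/setP => p; rewrite !inE ltnS leq_eqVlt.
Qed.

Lemma prefix_set0 s : prefix_set s 0 = set0.
Proof.
apply/setP => x; rewrite inE; apply/negbTE/imsetP => -[p].
by rewrite inE.
Qed.

Lemma prefix_set_full s k : n <= k -> prefix_set s k = setT.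
Proof.
move=> nk; apply/setP => x; rewrite inE; apply/imsetP; exists ((s^-1)%g x).
  by rewrite inE (leq_trans (ltn_ord _)).
by rewrite permKV.
Qed.

Lemma mem_prefix_set s (p : 'I_n) k : (s p \in prefix_set s k) = (p < k).
Proof. by rewrite (mem_imset _ _ perm_inj) inE. Qed.

Lemma count_below_preim w X d : count_below (w @^-1: X) d = #|prefix_set w d :&: X|.
Proof.
rewrite /count_below -[LHS](card_imset _ (@perm_inj _ w)); apply: eq_card => x.
rewrite -[x](permKV w) [LHS](mem_imset _ _ perm_inj) !inE mem_prefix_set.
by rewrite andbC.
Qed.

Lemma greedy_assignment u v Q s : selection u v Q ->
  exists w : 'S_n, forall k, Q (prefix_set s k) = w @^-1: prefix_set s k.
Proof.
move=> sQ.
have stepE (k : 'I_n) : exists p, (p \notin Q (prefix_set s k)) &&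
    (Q (prefix_set s k.+1) == p |: Q (prefix_set s k)).
  have := sel_setU1 (a := s k) (S := prefix_set s k) sQ.
  rewrite mem_prefix_set ltnn => /(_ isT)[p pN E].
  by exists p; rewrite pN prefix_setS E eqxx.
pose t k := xchoose (stepE k).
have tP k : t k \notin Q (prefix_set s k) /\
    Q (prefix_set s k.+1) = t k |: Q (prefix_set s k).
  by have /andP[? /eqP ?] := xchooseP (stepE k).
have mono k l : k <= l -> Q (prefix_set s k) \subset Q (prefix_set s l).
  move=> /subnKC <-; elim: (l - k) => [|m IHm]; first by rewrite addn0.
  rewrite addnS; apply: subset_trans IHm _.
  have [lt|ge] := ltnP (k + m) n.
    by have [_ /= ->] := tP (Ordinal lt); apply: subsetU1.
  by rewrite !prefix_set_full // leqW.
have t_lt (k l : 'I_n) : k < l -> t k != t l.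
  move=> kl; have [tkN tkE] := tP k; have [tlN _] := tP l.
  apply: contraNneq tlN => <-; apply: (subsetP (mono k.+1 l kl)).
  by rewrite tkE !inE eqxx.
have t_inj : injective t.
  move=> k l e; apply/val_inj/eqP; case: ltngtP => // lt.
    by have := t_lt _ _ lt; rewrite e eqxx.
  by have := t_lt _ _ lt; rewrite e eqxx.
(* The permutation sends t k, the position added at step k, to the value s k. *)
exists ((perm t_inj)^-1 * s)%g.
elim=> [|k IHk].
  rewrite prefix_set0 preimset0; apply/eqP; rewrite -cards_eq0 (sel_card sQ).
  by rewrite cards0.
have [lt|ge] := ltnP k n; last first.
  by rewrite prefix_set_full ?leqW // -(prefix_set_full s ge).
pose o := Ordinal lt; have [_ ->] := tP o.
rewrite IHk (prefix_setS s o); apply/setP => p; rewrite !inE permM; congr (_ || _).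
by rewrite (inj_eq perm_inj) (canF_eq (permKV _)) permE.
Qed.

(** The supermodular greedy argument: an element of T has a smaller marginal over T ∩ C than over
    the full chain member C, and the latter is its contribution to the count for w. *)
Lemma greedy_lower_bound u v Q s w T d : selection u v Q ->
  (forall k, Q (prefix_set s k) = w @^-1: prefix_set s k) ->
  count_below (Q T) d <= count_below (w @^-1: T) d.
Proof.
move=> sQ wE.
have SM := sel_supermodular sQ (@threshold_nonincreasing n d).
suff H k : count_below (Q (T :&: prefix_set s k)) d <=
           count_below (w @^-1: (T :&: prefix_set s k)) d.
  by have := H n; rewrite prefix_set_full // setIT.
elim: k => [|k IHk].
  rewrite prefix_set0 setI0 preimset0.
  have -> : Q set0 = set0 by apply/eqP; rewrite -cards_eq0 (sel_card sQ) cards0.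
  by [].
have [lt|ge] := ltnP k n; last first.
  by rewrite !prefix_set_full ?(leqW ge) // -(prefix_set_full s ge).
pose o := Ordinal lt.
have soE : prefix_set s k.+1 = s o |: prefix_set s k := prefix_setS s o.
have [oT|oT] := boolP (s o \in T); last first.
  rewrite (_ : T :&: prefix_set s k.+1 = T :&: prefix_set s k) //.
  rewrite soE setIUr (_ : T :&: [set s o] = set0) ?set0U //.
  by apply/setP => x; rewrite !inE; case: eqP => [->|]; rewrite ?(negPf oT) ?andbF.
have -> : T :&: prefix_set s k.+1 = s o |: (T :&: prefix_set s k).
  by rewrite soE setIUr (setIidPr _) // sub1set.
have oN : s o \notin prefix_set s k by rewrite mem_prefix_set ltnn.
have := supermodular_incr SM (subsetIr T (prefix_set s k)) oN.
rewrite -soE !wE !weight_threshold soE.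
have preU X : s o \notin X ->
    count_below (w @^-1: (s o |: X)) d =
    ((w^-1)%g (s o) < d) + count_below (w @^-1: X) d.
  move=> oX; rewrite !count_below_preim setIC card_setU1I // setIC; congr (_ + _).
  by rewrite -{1}(permKV w (s o)) mem_prefix_set.
rewrite !preU ?inE ?negb_and ?oN ?orbT //.
by move: IHk; lia.
Qed.

(** On up-sets [Q] is given by u, and the lower bounds become u ≤ w in the tableau criterion. On
    down-sets [Q] is given by v, and complementation turns the bounds into w ≤ v. *)
Lemma greedy_perm u v Q s : selection u v Q ->
  exists w : 'S_n, [/\ bruhat_le u w, bruhat_le w v &
    forall k, Q (prefix_set s k) = w @^-1: prefix_set s k].
Proof.
move=> sQ; have [w wE] := greedy_assignment s sQ.
have lb T d := greedy_lower_bound T d sQ wE.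
exists w; split=> //; apply/bruhat_leE => d m.
  have := lb [set x : 'I_n | m <= x] d; rewrite (sel_upper sQ).
  rewrite !height_prefix /count_below => le_uw.
  apply: leq_trans (leq_trans le_uw _); apply: eq_leq; apply: eq_card => p;
    by rewrite !inE andbC.
have split_card (y : 'S_n) : #|[set p : 'I_n | p < d]| =
    height (prefix_set y d) m + count_below [set p | y p < m] d.
  rewrite height_prefix /count_below -[LHS](cardsID [set p | m <= y p]).
  by congr (_ + _); apply: eq_card => p; rewrite !inE // -ltnNge.
have := lb [set x : 'I_n | x < m] d; rewrite (sel_lower sQ).
rewrite (_ : w @^-1: [set x : 'I_n | x < m] = [set p | w p < m]); last first.
  by apply/setP => p; rewrite !inE.
by have := split_card v; rewrite (split_card w); lia.
Qed.

Lemma sel_lower_bound u v Q w S d : selection u v Q ->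
  bruhat_le u w -> bruhat_le w v ->
  count_below (Q S) d <= count_below (w @^-1: S) d.
Proof.
move=> sQ /bruhat_leE uw /bruhat_leE wv; rewrite count_below_preim.
by apply: (sel_bound sQ _ (wv d)) => m; apply/esym/maxn_idPl.
Qed.

Lemma weight_rank X : weight (@rank_weight n) X = (\sum_(d < n) count_below X d.+1)%N.
Proof.
have sumE m (q : nat) : \sum_(d < m) (q < d.+1) = m - q.
  by elim: m => [|m IHm]; rewrite ?big_ord0 // big_ord_recr /= IHm; lia.
rewrite raddf_sum /=; under eq_bigr do rewrite -weight_threshold /weight.
rewrite exchange_big /weight; apply: eq_bigr => q _.
by rewrite /rank_weight /threshold -sumE raddf_sum.
Qed.

Lemma weight_rank_le X Y : (forall d, count_below X d <= count_below Y d) ->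
  (weight (@rank_weight n) X <= weight (@rank_weight n) Y)%R.
Proof. by move=> le; rewrite !weight_rank lez_nat; apply: leq_sum. Qed.

End Greedy.

From mathcomp Require Import boolp classical_sets reals.
From mathcomp Require Import lra.

(** * Linear functionals on convex hulls *)

Section ConvexHulls.
Variables (R : realType) (n : nat).
Implicit Types (X : set 'rV[R]_n) (c d x y p q : 'rV[R]_n).
Local Open Scope ring_scope.

Lemma dotDl c d x : dot (c + d) x = dot c x + dot d x.
Proof. by rewrite /dot -big_split; apply: eq_bigr => i _; rewrite mxE mulrDl. Qed.

Lemma dotZl r c x : dot (r *: c) x = r * dot c x.
Proof. by rewrite /dot mulr_sumr; apply: eq_bigr => i _; rewrite mxE mulrA. Qed.

Lemma dotC c x : dot c x = dot x c.
Proof. by apply: eq_bigr => i _; rewrite mulrC. Qed.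

Lemma dotDr c x y : dot c (x + y) = dot c x + dot c y.
Proof. by rewrite dotC dotDl !(dotC c). Qed.

Lemma dotZr r c x : dot c (r *: x) = r * dot c x.
Proof. by rewrite dotC dotZl (dotC c). Qed.

Lemma dotNr c x : dot c (- x) = - dot c x.
Proof. by rewrite -scaleN1r dotZr mulN1r. Qed.

Lemma dotNl c x : dot (- c) x = - dot c x.
Proof. by rewrite dotC dotNr dotC. Qed.

Lemma dot_self_eq0 x : dot x x <= 0 -> x = 0.
Proof.
move=> le0; apply/rowP => i; rewrite mxE; apply/eqP; rewrite -sqrf_eq0 eq_le sqr_ge0 andbT.
apply: le_trans le0; rewrite /dot (bigD1 i) //= -expr2 lerDl.
by apply: sumr_ge0 => j _; rewrite -expr2 sqr_ge0.
Qed.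

Lemma sub_conv_hull X x : X x -> conv_hull X x.
Proof.
move=> Xx; exists 1%N, (fun=> 1), (fun=> x); split=> //.
  by rewrite big_ord1.
by rewrite big_ord1 scale1r.
Qed.

Lemma conv_hull_dot_le X c x : conv_hull X x -> exists2 y, X y & dot c x <= dot c y.
Proof.
move=> [k [l [p [l0 l1 Xp ->]]]].
have k0 : (0 < k)%N.
  by case: k l p l0 l1 Xp => // l p _; rewrite big_ord0 => /eqP; rewrite eq_sym oner_eq0.
pose i0 := Ordinal k0.
case: (@arg_maxP _ _ _ i0 xpredT (fun i => dot c (p i)) isT) => i _ imax.
exists (p i); first exact: Xp.
have -> : dot c (\sum_j l j *: p j) = \sum_j l j * dot c (p j).
  rewrite (big_morph (dot c) (id1 := 0) (op1 := +%R)).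
  - by apply: eq_bigr => j _; rewrite dotZr.
  - exact: dotDr.
  - by rewrite -(scale0r (0 : 'rV[R]_n)) dotZr mul0r.
rewrite -[leRHS]mul1r -l1 mulr_suml; apply: ler_sum => j _.
by apply: ler_wpM2l => //; apply: imax.
Qed.

Lemma conv_hull_pair p q x : conv_hull [set p; q] x ->
  exists t : R, x = p + t *: (q - p).
Proof.
move=> [k [l [y [l0 l1 yP ->]]]].
have {}yP i : exists s : R, y i = p + s *: (q - p).
  case: (yP i) => /= ->; first by exists 0; rewrite scale0r addr0.
  by exists 1; rewrite scale1r addrC subrK.
have [s sP] := choice yP.
exists (\sum_i l i * s i); rewrite scaler_suml.
under eq_bigr do rewrite sP scalerDr scalerA.
by rewrite big_split /= -scaler_suml l1 scale1r.
Qed.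

End ConvexHulls.

(** * Permutations sorting a linear functional *)

Section SortingPermutations.
Variables (R : realType) (n : nat).
Implicit Types (e c d x y : 'rV[R]_n) (s t : 'S_n) (i j k : 'I_n).
Local Open Scope ring_scope.

Definition sorts e s := forall i j, (i < j)%N -> e 0 (s i) <= e 0 (s j).

Lemma sorts_exists e : exists s, sorts e s.
Proof.
pose l := sort (fun i j => e 0 i <= e 0 j) (enum 'I_n).
have szl : size l = n by rewrite size_sort size_enum_ord.
have ul : uniq l by rewrite sort_uniq enum_uniq.
pose f (k : 'I_n) := nth k l k.
have fE k i : f k = nth i l k by apply: set_nth_default; rewrite szl.
have f_inj : injective f.
  move=> i j; rewrite (fE i i) (fE j i) => /eqP.
  by rewrite nth_uniq ?szl // => /eqP/val_inj.
exists (perm f_inj) => i j ij; rewrite !permE (fE i i) (fE j i).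
apply: (sorted_leq_nth (leT := fun i j => e 0 i <= e 0 j)); rewrite ?inE ?szl ?(ltnW ij) //.
  by move=> ? ? ?; apply: le_trans.
by apply: sort_sorted => ? ?; apply: le_total.
Qed.

(* Abel summation against the nonnegative partial sums. *)
Lemma sorts_sum_le (e D : 'I_n -> R) :
  (forall i j, (i < j)%N -> e i <= e j) ->
  (forall m, 0 <= \sum_(k < n | (k < m)%N) D k) -> \sum_k D k = 0 ->
  \sum_k e k * D k <= 0.
Proof.
move=> e_mono D0 Dn; case: (posnP n) => [n0|n_gt0].
  by rewrite big1 // => k; have := ltn_ord k; rewrite [in X in (_ < X)%N]n0.
have stepE (F : 'I_n -> R) (o : 'I_n) :
    \sum_(k < n | (k < o.+1)%N) F k = \sum_(k < n | (k < o)%N) F k + F o.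
  rewrite (bigD1 o) //= addrC; congr (_ + _); apply: eq_bigl => k.
  by rewrite ltnS andbC -(inj_eq val_inj) /= -ltn_neqAle.
have H m (lt : (m < n)%N) : \sum_(k < n | (k < m.+1)%N) e k * D k <=
    e (Ordinal lt) * \sum_(k < n | (k < m.+1)%N) D k.
  elim: m lt => [|m IHm] lt; rewrite !(stepE _ (Ordinal lt)).
    by rewrite !big_pred0 // !add0r.
  rewrite mulrDr lerD2r; have ltm := ltnW lt.
  apply: le_trans (IHm ltm) _; apply: ler_wpM2r => //.
  exact: e_mono.
have lt : (n.-1 < n)%N by rewrite prednK.
have allE (F : 'I_n -> R) : \sum_(k < n | (k < n)%N) F k = \sum_k F k.
  by apply: eq_bigl => k; rewrite ltn_ord.
by have := H _ lt; rewrite prednK // !allE Dn mulr0.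
Qed.

Lemma small_perturbation c d : exists2 r : R, 0 < r &
  forall s, sorts (c + r *: d) s -> sorts c s.
Proof.
(* The number r is at most every strict gap of c divided by one plus the corresponding difference of
   d, so adding r d cannot close a gap. The added one keeps denominators positive and the inequality
   strict. *)
pose f (p : 'I_n * 'I_n) : R := (c 0 p.2 - c 0 p.1) / (1 + `|d 0 p.1 - d 0 p.2|).
pose r : R := \big[Num.min/1]_(p | c 0 p.1 < c 0 p.2) f p.
have den0 p : 0 < 1 + `|d 0 p.1 - d 0 p.2| :> R.
  by rewrite ltr_pwDl.
have r0 : 0 < r.
  by rewrite lt_bigmin // => p lt; rewrite divr_gt0 // subr_gt0.
exists r => // s sorts_s i j ij; rewrite leNgt; apply/negP => lt.
have := sorts_s i j ij; rewrite !mxE leNgt => /negP; apply.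
have rle : r <= f (s j, s i) by apply: bigmin_le_cond.
move: rle; rewrite /f /= ler_pdivlMr ?(den0 (s j, s i)) // mulrDr mulr1 => rle.
have := ler_norm (d 0 (s j) - d 0 (s i)); rewrite -(ler_pM2l r0) mulrBr.
move: rle r0; set N := r * `|_| ; lra.
Qed.

Lemma sorts_swap c s i j : j = i.+1 :> nat -> sorts c s ->
  c 0 (s i) = c 0 (s j) -> sorts c (perm_comp s (tperm i j)).
Proof.
move=> ji so eq_c x y xy; rewrite !permM.
have tE z : c 0 (s (tperm i j z)) = c 0 (s z).
  by case: tpermP => [->|->|].
by rewrite !tE so.
Qed.

(* Two permutations sorting [c] are joined by adjacent swaps through permutations
   sorting [c]: an adjacent inversion of one relative to the other is a tie of [c]. *)
Lemma sorts_connected c (P : 'S_n -> Prop) t :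
  sorts c t -> P t ->
  (forall s i j, j = i.+1 :> nat -> sorts c s ->
    sorts c (perm_comp s (tperm i j)) -> P (perm_comp s (tperm i j)) -> P s) ->
  forall s, sorts c s -> P s.
Proof.
move=> ct Pt step s; have [k] := ubnP (inversions (perm_comp (t^-1)%g s)).
elim: k => // k IHk in s *; rewrite ltnS => lek cs.
pose w := perm_comp (t^-1)%g s.
have [/existsP[i /existsP[j /andP[/eqP ji lt]]]|no] :=
    boolP [exists i : 'I_n, exists j : 'I_n, (j == i.+1 :> nat) && (w j < w i)%N].
  have eq_c : c 0 (s i) = c 0 (s j).
    apply/eqP; rewrite eq_le cs ?ji //=.
    by have := ct _ _ lt; rewrite !permM !permKV.
  have cs' := sorts_swap ji cs eq_c.
  apply: (step _ _ _ ji cs cs'); apply: IHk => //.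
  apply: leq_trans lek; rewrite -/w (inversions_swapr_desc ji lt).
  by rewrite /w /perm_comp mulgA.
have w1 : w = 1%g.
  apply: perm_increasing => i j ji.
  have /orP[//|lt] := perm_neq_lt w (succ_neq ji).
  by case/negP: no; apply/existsP; exists i; apply/existsP; exists j; rewrite ji eqxx.
suff -> : s = t by [].
by apply: (mulIg (t^-1)%g); rewrite mulgV.
Qed.

End SortingPermutations.

(** * Faces, edges and the supermodular function of the twisted polytope *)

Section TwistedPolytope.
Variables (R : realType) (n : nat) (u v : 'S_n) (Q : {set 'I_n} -> {set 'I_n}).
Hypothesis sQ : selection u v Q.
Implicit Types (S : {set 'I_n}) (w s : 'S_n) (i j : 'I_n) (c x y p q : 'rV[R]_n).
Local Open Scope ring_scope.

Local Notation P := (twisted_bruhat_interval_polytope R u v).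
Local Notation pt := (@twisted_point R n).

Local Notation full := (finset.setTfor 'I_n).

Definition sel_min S : R := (weight (@rank_weight n) (Q S))%:~R.

Lemma twisted_point_rank w i : pt w 0 i = (rank_weight ((w^-1)%g i))%:~R.
Proof.
rewrite mxE /rank_weight -natrB; last by rewrite ltnS ltnW.
by rewrite subSS.
Qed.

Lemma twisted_point_sum w S :
  \sum_(i in S) pt w 0 i = (weight (@rank_weight n) (w @^-1: S))%:~R.
Proof.
rewrite /weight (rmorph_sum intr) /= (reindex_inj (@perm_inj _ w)) /=.
apply: eq_big => [q|q _]; first by rewrite inE.
by rewrite twisted_point_rank permK.
Qed.

Lemma dot_indicator S x : dot (\row_i (i \in S)%:R) x = \sum_(i in S) x 0 i.
Proof.
rewrite /dot [RHS]big_mkcond; apply: eq_bigr => i _; rewrite mxE.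
by case: (i \in S); rewrite ?mul1r ?mul0r.
Qed.

Lemma sel_min_le x S : P x -> sel_min S <= \sum_(i in S) x 0 i.
Proof.
move=> Px; rewrite -dot_indicator -[dot _ _]opprK -dotNl lerNr.
have [y [w [uw wv] <-]] := conv_hull_dot_le (- \row_i (i \in S)%:R) Px.
move=> /le_trans; apply; rewrite dotNl lerN2 dot_indicator twisted_point_sum ler_int.
by apply: weight_rank_le => d; apply: (sel_lower_bound S d sQ).
Qed.

Lemma sel_min_greedy : exists W : 'S_n -> 'S_n, forall s,
  P (pt (W s)) /\
  forall k, \sum_(i in prefix_set s k) pt (W s) 0 i = sel_min (prefix_set s k).
Proof.
suff H s : exists w, P (pt w) /\
    forall k, \sum_(i in prefix_set s k) pt w 0 i = sel_min (prefix_set s k).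
  by have [W WP] := choice H; exists W.
have [w [uw wv wE]] := greedy_perm s sQ; exists w; split.
  by apply: sub_conv_hull; exists w.
by move=> k; rewrite twisted_point_sum /sel_min wE.
Qed.

Lemma set_prefix S : exists s k, S = prefix_set s k.
Proof.
(* Sorting by the indicator of the complement lists S first. The first index outside S is then the
   prefix length; for the full set it is n, where [out] holds vacuously. *)
pose e : 'rV[R]_n := \row_i (i \notin S)%:R.
have [s es] := sorts_exists e.
have down (i j : 'I_n) : (i < j)%N -> s j \in S -> s i \in S.
  move=> ij sj; have := es i j ij; rewrite !mxE sj /=.
  by case: (s i \in S) => //=; rewrite ler10.
pose out k := [forall i : 'I_n, (i == k :> nat) ==> (s i \notin S)].
have ex_out : exists k, out k.
  by exists n; apply/forallP => i; rewrite (ltn_eqF (ltn_ord i)).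
case: (ex_minnP ex_out) => k /forallP kS k_min; exists s, k.
apply/setP => x; rewrite -(permKV s x) mem_prefix_set; set i := (s^-1)%g x.
have [ik|] := ltnP i k.
  apply/negPn/negP => iS; suff /k_min : out i by rewrite leqNgt ik.
  by apply/forallP => j; apply/implyP => /eqP/val_inj ->.
rewrite leq_eqVlt => /orP[/eqP ki|ki]; apply/negbTE; first by have := kS i; rewrite ki eqxx.
have lt : (k < n)%N := ltn_trans ki (ltn_ord i).
by apply: contra (down (Ordinal lt) i ki) _; have := kS (Ordinal lt); rewrite eqxx.
Qed.

Lemma total_sum x : P x -> \sum_i x 0 i = sel_min full.
Proof.
move=> Px; apply/eqP; rewrite eq_le.
have setE : \sum_i x 0 i = \sum_(i in full) x 0 i.
  by apply: eq_bigl => i; rewrite inE.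
rewrite setE sel_min_le // andbT -dot_indicator.
have [y [w _ <-] /le_trans] := conv_hull_dot_le (\row_i (i \in full)%:R) Px.
apply.
rewrite dot_indicator twisted_point_sum /sel_min.
have fullE (X : {set 'I_n}) : #|X| = #|full| -> X = full.
  by move=> e; apply/eqP; rewrite eqEcard finset.subsetT e leqnn.
by rewrite preimsetT (fullE (Q full)) ?(sel_card sQ).
Qed.

(** Relative to the greedy vertex, y has prefix sums at least as large and the same total, so Abel
    summation applies to the difference. *)
Lemma sorts_dot_max c s w : sorts c s ->
  P (pt w) -> (forall k, \sum_(i in prefix_set s k) pt w 0 i = sel_min (prefix_set s k)) ->
  forall y, P y -> dot c y <= dot c (pt w).
Proof.
move=> cs Pw wE y Py; rewrite -subr_le0 -dotNr -dotDr /dot.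
rewrite (reindex_inj (@perm_inj _ s)) /=.
apply: (sorts_sum_le (e := fun k => c 0 (s k)) (D := fun k => (y - pt w) 0 (s k))) => //.
- move=> m; have -> : \sum_(k < n | (k < m)%N) (y - pt w) 0 (s k) =
      \sum_(i in prefix_set s m) (y - pt w) 0 i.
    rewrite [RHS](reindex_inj (@perm_inj _ s)) /=.
    by apply: eq_bigl => k; rewrite mem_prefix_set.
  under eq_bigr do rewrite mxE mxE.
  by rewrite big_split sumrN /= wE subr_ge0 sel_min_le.
- rewrite -(reindex_inj (@perm_inj _ s) (F := fun i => (y - pt w) 0 i) (P := xpredT)) /=.
  under eq_bigr do rewrite mxE mxE.
  by rewrite big_split sumrN /= !total_sum // subrr.
Qed.

(** The two chains differ only in the prefix of size j. The prefix sums of the difference vanish at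
    all other sizes, so it is supported on s i and s j, with opposite values. *)
Lemma adjacent_difference s i j w w' : j = i.+1 :> nat ->
  (forall k, \sum_(h in prefix_set s k) pt w 0 h = sel_min (prefix_set s k)) ->
  (forall k, \sum_(h in prefix_set (perm_comp s (tperm i j)) k) pt w' 0 h =
             sel_min (prefix_set (perm_comp s (tperm i j)) k)) ->
  exists r, pt w' - pt w = r *: (std_basis R (s i) - std_basis R (s j)).
Proof.
move=> ji wE w'E; set s' := perm_comp s (tperm i j) in w'E; pose D := pt w' - pt w.
have ij := succ_neq ji.
have prefE k : k <> j :> nat -> prefix_set s' k = prefix_set s k.
  move=> kj; apply/setP => x; rewrite -(permKV s x) mem_prefix_set.
  set y := (s^-1)%g x.
  have -> : s y = s' (tperm i j y) by rewrite permM tpermK.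
  by rewrite mem_prefix_set; case: tpermP => [->|->|//]; move: ji kj; lia.
have D0 k : k <> j :> nat -> \sum_(h in prefix_set s k) D 0 h = 0.
  have DE h : D 0 h = pt w' 0 h - pt w 0 h by rewrite [LHS]mxE [X in _ + X = _]mxE.
  move=> kj; under eq_bigr do rewrite DE.
  by rewrite big_split sumrN /= wE -(prefE k kj) w'E subrr.
have DS (l : 'I_n) : \sum_(h in prefix_set s l.+1) D 0 h =
    D 0 (s l) + \sum_(h in prefix_set s l) D 0 h.
  by rewrite prefix_setS big_setU1 // mem_prefix_set ltnn.
have Dl l : l != i -> l != j -> D 0 (s l) = 0.
  move=> li lj; have := DS l; rewrite !D0 ?addr0 //.
    by move=> /val_inj e; rewrite e eqxx in lj.
  by rewrite ji => -[] /val_inj e; rewrite e eqxx in li.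
have Dij : D 0 (s j) = - D 0 (s i).
  have := DS j; rewrite D0; last by lia.
  rewrite ji DS D0; last by lia.
  by rewrite addr0 => /esym/eqP; rewrite addr_eq0 => /eqP.
have basisE h : (std_basis R (s i) - std_basis R (s j)) 0 h = (h == s i)%:R - (h == s j)%:R.
  by rewrite !mxE eqxx.
exists (D 0 (s i)); rewrite -/D; apply/rowP => x; rewrite -(permKV s x).
set l := (s^-1)%g x; rewrite [RHS]mxE basisE !(inj_eq perm_inj).
have [->|li] := eqVneq l i; first by rewrite (negPf ij) subr0 mulr1.
have [->|lj] := eqVneq l j; first by rewrite sub0r mulrN1 Dij.
by rewrite Dl // subrr mulr0.
Qed.

(* The greedy vertices sorting c + r1 d and c - r2 d, with d = q - p, lie at
   opposite ends of the edge, so a path of adjacent swaps between them moves. *)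
Lemma edge_direction p q : edge P p q ->
  exists (i j : 'I_n) (r : R), i != j /\ q - p = r *: (std_basis R i - std_basis R j).
Proof.
move=> [pq [c faceE]]; apply/not_existsP => no.
have [W WP] := sel_min_greedy.
have inP x : conv_hull [set p; q] x -> P x /\ forall y, P y -> dot c y <= dot c x.
  by rewrite -faceE.
have [Pp pmax] : P p /\ forall y, P y -> dot c y <= dot c p.
  by apply: inP; apply: sub_conv_hull; left.
have [Pq qmax] : P q /\ forall y, P y -> dot c y <= dot c q.
  by apply: inP; apply: sub_conv_hull; right.
have Wmax s e : sorts e s -> forall y, P y -> dot e y <= dot e (pt (W s)).
  by move=> es; apply: (sorts_dot_max es); apply WP.
have Wline s : sorts c s -> exists t : R, pt (W s) = p + t *: (q - p).
  move=> cs; apply: conv_hull_pair; rewrite -faceE; split; first by apply WP.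
  exact: Wmax.
have [d dE] : exists d, d = q - p by exists (q - p).
have [r1 r1_gt0 sort1] := small_perturbation c d.
have [r2 r2_gt0 sort2] := small_perturbation c (- d).
have [s1 s1P] := sorts_exists (c + r1 *: d).
have [s2 s2P] := sorts_exists (c + r2 *: - d).
have same : pt (W s1) = pt (W s2).
  (* All these vertices maximise c, hence lie on the line through p and q. A nonzero step along that
     line would make q - p a multiple of some e_i - e_j, which [no] excludes. *)
  apply: (sorts_connected (c := c) (P := fun s => pt (W s) = pt (W s2)) (t := s2)) => //.
  - exact: sort2.
  - move=> s i j ji cs cs' <-.
    have [r rE] := adjacent_difference ji (WP s).2 (WP _).2.
    have [t tE] := Wline _ cs; have [t' t'E] := Wline _ cs'.
    have [tt|tt] := eqVneq t t'; first by rewrite tE t'E tt.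
    case: (no (s i)); exists (s j), (r / (t' - t)); split.
      by rewrite (inj_eq perm_inj) succ_neq.
    have ttE : (t' - t) *: (q - p) = r *: (std_basis R (s i) - std_basis R (s j)).
      by rewrite -rE tE t'E opprD addrACA subrr add0r -scalerBl.
    rewrite mulrC -scalerA -ttE scalerA mulVf ?scale1r //.
    by rewrite subr_eq0 eq_sym.
  - exact: sort1.
have c1 : dot c (pt (W s1)) = dot c p.
  by apply/eqP; rewrite eq_le pmax ?Wmax //; [apply: sort1|apply WP].
have cq : dot c q = dot c p by apply/eqP; rewrite eq_le pmax // qmax.
(* The common vertex is at least as far along d as q and at most as far as p, which forces d · d ≤
   0. *)
have dq : dot d q <= dot d (pt (W s1)).
  have := Wmax _ _ s1P q Pq; rewrite !dotDl c1 cq lerD2l !dotZl.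
  by rewrite ler_pM2l.
have dp : dot d (pt (W s1)) <= dot d p.
  have := Wmax _ _ s2P p Pp; rewrite -same !dotDl c1 lerD2l !dotZl !dotNl.
  by rewrite ler_pM2l // lerN2.
have d0 : d = 0.
  apply: dot_self_eq0; rewrite {2}dE dotDr dotNr subr_le0.
  exact: le_trans dp.
by move: pq; rewrite eq_sym -subr_eq0 -dE d0 eqxx.
Qed.

(** Some generator attains the maximum defining the vertex, so the vertex is itself a twisted
    point. *)
Lemma vertex_int p : vertex P p -> forall i, p 0 i \is a Num.int.
Proof.
move=> [c faceE] i.
have [Pp pmax] : P p /\ forall y, P y -> dot c y <= dot c p.
  by have : face P c p by rewrite faceE.
have [y [w wuv <-] le_py] := conv_hull_dot_le c Pp.
have Pw : P (pt w) by apply: sub_conv_hull; exists w.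
have : face P c (pt w) by split=> // z Pz; apply: le_trans (pmax _ Pz) le_py.
by rewrite faceE => <-; rewrite twisted_point_rank intr_int.
Qed.

Lemma sel_min_supermodular_function : is_supermodular_function P sel_min.
Proof.
move=> S; split; last by move=> x Px; apply: sel_min_le.
have [W WP] := sel_min_greedy; have [s [k ->]] := set_prefix S.
by exists (pt (W s)); apply WP.
Qed.

Lemma twisted_polytope : polytope P.
Proof.
exists [seq pt w | w <- enum 'S_n & `[< bruhat_interval u v w >]].
congr conv_hull; apply/seteqP; split=> x /=.
  move=> [w wuv <-]; apply/mapP; exists w => //.
  by rewrite mem_filter mem_enum andbT; apply/asboolP.
by move=> /mapP[w + ->]; rewrite mem_filter => /andP[/asboolP wuv _]; exists w.
Qed.

Lemma sel_min_mv S (a b c : 'I_n) :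
  a \notin S -> b \notin S -> c \notin S -> (a < b)%N -> (b < c)%N ->
  sel_min (b |: S) + sel_min ([set a; c]%SET :|: S) =
  Num.min (sel_min (a |: S) + sel_min ([set b; c]%SET :|: S))
          (sel_min ([set a; b]%SET :|: S) + sel_min (c |: S)).
Proof.
move=> aS bS cS ab bc; rewrite -!finset.setUA /sel_min -!intrD.
rewrite (sel_mv sQ (@rank_weight_nonincreasing n) ab bc aS bS cS).
by rewrite !minEle ler_int; case: ifP.
Qed.

End TwistedPolytope.

Theorem proposition5p9 (R : realType) (n : nat) (u v : 'S_n) :
  bruhat_le u v -> left_weak_le u v ->
  MV_polytope (twisted_bruhat_interval_polytope R u v).
Proof.
move=> _ /left_weak_selection[Q sQ]; split.
  split; first by split; [exact: twisted_polytope | exact: (edge_direction sQ)].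
  exact: vertex_int.
exists (sel_min R Q); split; first exact: (sel_min_supermodular_function R sQ).
exact: (sel_min_mv R sQ).
Qed.
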